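(* There is a constant $C<\infty$ such that for all positive integers $k$ there is a $k\times k$ matrix $B$ with $\pm1$ entries such that \[ \sqrt{2k}\,\max\Big\{\max_{D}\frac{\Delta_2(D,B)}{\Delta_1(D,B)},\ \max_{D'}\frac{\Delta_2(D',B^* )}{\Delta_1(D',B^* )}\Big\}\le C , \] where the first inner maximum is taken over all $l=1,2,\dots,k-1$ and over all $(l+1)\times l$ submatrices $D$ of $B$ for which the denominator is not zero, and the second inner maximum is taken over all $l=1,2,\dots,k-1$ and over all $(l+1)\times l$ submatrices $D'$ of $B^*$ for which the denominator is not zero. Moreover, the left hand side of this inequality is equal to $\max\{C_{2k}(E),C_{2k}(E^{\bot})\}$, where $E\subseteq\mathbb{R}^{2k}$ is the span of the rows of the $k\times 2k$ matrix $[\sqrt{k}\,I_k,\,B]$.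
   Context: For $0<p<\infty$ and $n\in\mathbb{N}$, $\|x\|_{L_p^n}=\big(n^{-1}\sum_{i=1}^n|x_i|^p\big)^{1/p}$ for $x\in\mathbb{R}^n$. For a subset $E\subseteq\mathbb{R}^n$, \[C_n(E)=\sup\{\|x\|_{L_2^n}/\|x\|_{L_1^n}\ ;\ x\in E,\ x\neq0\}.\] $E^\bot$ is the orthogonal complement of $E$ in $\mathbb{R}^{2k}$ with respect to the inner product induced by $\|\cdot\|_{L_2^{2k}}$ (equivalently, the usual inner product). $B^*$ is the transpose of $B$, $I_k$ is the $k\times k$ identity matrix, and $[\sqrt{k}\,I_k,B]$ is the matrix whose first $k$ columns form $\sqrt{k}\,I_k$ and whose last $k$ columns form $B$. For a $k\times k$ matrix $B$ and subsets $R,S\subseteq\{1,\dots,k\}$, $B_{R,S}$ denotes the submatrix of $B$ formed by the rows in $R$ and the columns in $S$. For a submatrix $D=B_{R,S}$ (considered together with $R$ and $S$), $i\in R$ and $j\in\{1,\dots,k\}\setminus S$, put $D_{-i}=B_{R\setminus\{i\},S}$ and $D^{+j}=B_{R,S\cup\{j\}}$. For $l=1,\dots,k-1$, an $(l+1)\times l$ submatrix $D=B_{R,S}$ of $B$ (so $|R|=l+1$, $|S|=l$) and $p=1,2$, \[ \Delta_p(D,B)=\Big(k^{p/2}\sum_{i\in R}|\det D_{-i}|^p+\sum_{j\in\{1,\dots,k\}\setminus S}|\det D^{+j}|^p\Big)^{1/p}. \] $\Delta_p(D',B^* )$ is defined in the same way with $B^*$ in place of $B$.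
   Formalization: The ''Moreover'' identity is stated for k ≥ 2 (and every ±1 matrix B): at k = 1 there is no l in 1,…,k−1, so both inner maxima are over the empty set while the right-hand side is 1; in the inequality the empty maximum is taken as 0. *)

(* Defs.v *)
From HB Require Import structures.
From mathcomp Require Import all_boot all_order all_algebra.
From mathcomp Require Import boolp classical_sets reals exp.

Set Implicit Arguments.
Unset Strict Implicit.
Unset Printing Implicit Defensive.

Import Order.TTheory GRing.Theory Num.Theory.

Local Open Scope classical_set_scope.
Local Open Scope ring_scope.

Definition avg_norm (R : realType) (n : nat) (p : R) (x : 'rV[R]_n) : R :=
  (n%:R^-1 * \sum_(i < n) `|x 0 i| `^ p) `^ p^-1.

(* The set is bounded above by sqrt n, so this is its genuine supremum as soon
   as E contains a nonzero vector. *)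
Definition norm_distortion (R : realType) (n : nat) (E : set 'rV[R]_n) : R :=
  sup [set avg_norm 2 x / avg_norm 1 x | x in E `&` [set x | x != 0]].

Definition orth_compl (R : realType) (n : nat) (E : set 'rV[R]_n)
    : set 'rV[R]_n :=
  [set y | forall x, E x -> \sum_(i < n) x 0 i * y 0 i = 0].

Definition sign_matrix (R : realType) (k : nat) (B : 'M[R]_k) : Prop :=
  forall i j, B i j = 1 \/ B i j = -1.

Definition row_span (R : realType) (m n : nat) (M : 'M[R]_(m, n))
    : set 'rV[R]_n :=
  [set x | (x <= M)%MS].

(* The span of the rows of [sqrt k I_k, B]. *)
Definition sqrtI_span (R : realType) (k : nat) (B : 'M[R]_k)
    : set 'rV[R]_(k + k) :=
  row_span (row_mx (Num.sqrt k%:R)%:M B).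

(* B_{P,S}, the rows and columns being listed in increasing order. *)
Definition submatrix (R : realType) (k : nat) (B : 'M[R]_k)
    (P S : {set 'I_k}) : 'M[R]_(#|P|, #|S|) :=
  mxsub enum_val enum_val B.

(* conform_mx only identifies the propositionally equal dimensions #|P| and
   #|S|; the default value 0 is used only when B_{P,S} is not square. *)
Definition subdet (R : realType) (k : nat) (B : 'M[R]_k)
    (P S : {set 'I_k}) : R :=
  \det (conform_mx (0 : 'M[R]_#|P|) (submatrix B P S)).

(* Delta_p(B_{P,S}, B), meant for #|P| = #|S| + 1. *)
Definition Delta (R : realType) (k : nat) (p : R) (B : 'M[R]_k)
    (P S : {set 'I_k}) : R :=
  (k%:R `^ (p / 2) * \sum_(i in P) `|subdet B (P :\ i)%SET S| `^ p
   + \sum_(j in (~: S)%SET) `|subdet B P (j |: S)%SET| `^ p) `^ p^-1.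

(* The ratios are nonnegative, so starting the maxima at 0 does not change
   them; for k = 1 there is no D at all and the value is 0. *)
Definition max_Delta_ratio (R : realType) (k : nat) (B : 'M[R]_k) : R :=
  \big[Num.max/0]_(1 <= l < k)
    \big[Num.max/0]_(P : {set 'I_k} | #|P| == l.+1)
      \big[Num.max/0]_(S : {set 'I_k} | (#|S| == l) && (Delta 1 B P S != 0))
        (Delta 2 B P S / Delta 1 B P S).

Definition Delta_bound (R : realType) (k : nat) (B : 'M[R]_k) : R :=
  Num.sqrt (2 * k%:R) * Num.max (max_Delta_ratio B) (max_Delta_ratio B^T).

(* Main.v *)
(* Every element of E has the form x(a) = (sqrt k a, a B). A vector of E whose
   support is not minimal in E is a sum of two vectors of E with smaller supports
   and the same sign pattern; the l1 norm is additive on such a sum and the l2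
   norm subadditive, so the ratio of the two norms is maximal at a vector of
   minimal support. By Cramer's rule these are the vectors of minors defining
   Delta_1 and Delta_2. Exchanging the two halves, up to a sign, maps the
   orthogonal complement of E onto the subspace attached to the transpose of B.

   For the existence of B take random signs. Exponential moments over a grid give
   a matrix B such that B and its transpose have operator norm O(sqrt k) and such
   that |z B|_1 >= c k |z|_2 for all grid points z of small l1 norm. Hence for a
   unit vector a, either sqrt k |a|_1 is already of order k, or a is close to such
   a grid point and |a B|_1 is of order k, while the l2 norm of x(a) is
   O(sqrt k). *)

Require Import Defs.
From HB Require Import structures.
From mathcomp Require Import all_boot all_order all_algebra.
From mathcomp Require Import boolp classical_sets reals exp.
From mathcomp Require Import perm sequences.
From mathcomp Require Import zify ring lra.

Set Implicit Arguments.
Unset Strict Implicit.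
Unset Printing Implicit Defensive.

Import Order.TTheory GRing.Theory Num.Theory.

Local Open Scope classical_set_scope.
Local Open Scope ring_scope.

(** * Norms and vectors of minimal support *)

(** The two assertions are proved independently. For the bound, every ratio of Deltas is the ratio
    of norms of a single vector of E, so an estimate on all of E suffices and minimal supports do
    not enter. For the equality, sign entries and k > 1 matter: for k = 1 there is no D and the left
    side is 0, while E is a line of distortion 1.

    The obstacle in the bound is the lower estimate of |a B|_1. For one unit vector a the mean of
    exp(-2 |a B|_1) is only known to be at most (3/4)^k, and a fine net of the whole sphere has too
    many points to be paid for by this rate. Grid points of l1 size at most k / 120 are few enough.
    A vector a with larger l1 norm needs no estimate of a B, because sqrt k a is itself a part of
    x(a). The mesh 1 / (T sqrt k) is dictated by the operator norm 32 sqrt k: rounding a changes |a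
    B|_1 by at most 32 k / T. *)

Section Norms.
Context {R : rcfType} {n : nat}.
Implicit Types (x y z : 'rV[R]_n).

Definition dot x y : R := \sum_i x 0 i * y 0 i.
Definition norm1 x : R := \sum_i `|x 0 i|.
Definition norm2 x : R := Num.sqrt (dot x x).

Lemma dotC x y : dot x y = dot y x.
Proof. by apply: eq_bigr => i _; rewrite mulrC. Qed.

Lemma dotDl x y z : dot (x + y) z = dot x z + dot y z.
Proof. by rewrite -big_split; apply: eq_bigr => i _; rewrite mxE mulrDl. Qed.

Lemma dotZl c x y : dot (c *: x) y = c * dot x y.
Proof. by rewrite mulr_sumr; apply: eq_bigr => i _; rewrite mxE mulrA. Qed.

Lemma dot0l x : dot 0 x = 0.
Proof. by rewrite -[0](scale0r 0) dotZl mul0r. Qed.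

Lemma dotDr x y z : dot x (y + z) = dot x y + dot x z.
Proof. by rewrite dotC dotDl !(dotC x). Qed.

Lemma dotZr c x y : dot x (c *: y) = c * dot x y.
Proof. by rewrite dotC dotZl dotC. Qed.

Lemma dot_ge0 x : 0 <= dot x x.
Proof. by apply: sumr_ge0 => i _; rewrite -expr2 sqr_ge0. Qed.

Lemma norm2_ge0 x : 0 <= norm2 x.
Proof. exact: sqrtr_ge0. Qed.

Lemma norm1_ge0 x : 0 <= norm1 x.
Proof. exact: sumr_ge0. Qed.

Lemma sqr_norm2 x : norm2 x ^+ 2 = dot x x.
Proof. by rewrite sqr_sqrtr// dot_ge0. Qed.

Lemma dot_eq0 x : (dot x x == 0) = (x == 0).
Proof.
apply/idP/eqP => [|->]; last by rewrite dot0l.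
rewrite psumr_eq0 => [/allP x0|i _]; last by rewrite -expr2 sqr_ge0.
apply/rowP => i; rewrite mxE.
by have := x0 i (mem_index_enum _); rewrite /= mulf_eq0 orbb => /eqP.
Qed.

Lemma norm2_eq0 x : (norm2 x == 0) = (x == 0).
Proof. by rewrite -sqrf_eq0 sqr_norm2 dot_eq0. Qed.

Lemma norm2_gt0 x : (0 < norm2 x) = (x != 0).
Proof. by rewrite lt_def norm2_eq0 norm2_ge0 andbT. Qed.

Lemma norm2Z c x : norm2 (c *: x) = `|c| * norm2 x.
Proof. by rewrite /norm2 dotZl dotZr mulrA -expr2 sqrtrM ?sqr_ge0// sqrtr_sqr. Qed.

Lemma norm2_0 : norm2 0 = 0.
Proof. by apply/eqP; rewrite norm2_eq0. Qed.

Lemma norm1_0 : norm1 0 = 0.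
Proof. by apply: big1 => i _; rewrite mxE normr0. Qed.

Lemma norm1Z c x : norm1 (c *: x) = `|c| * norm1 x.
Proof. by rewrite mulr_sumr; apply: eq_bigr => i _; rewrite mxE normrM. Qed.

Lemma dot_le_norm2 x y : dot x y <= norm2 x * norm2 y.
Proof.
have [->|y0] := eqVneq y 0.
  by rewrite dotC dot0l norm2_0 mulr0.
have := dot_ge0 (dot y y *: x - dot x y *: y).
have yy : 0 < dot y y by rewrite lt_def dot_eq0 y0 dot_ge0.
rewrite -scaleNr !(dotDl, dotDr, dotZl, dotZr) (dotC y x) => h.
have {h} : 0 <= dot y y * (dot x x * dot y y - dot x y ^+ 2) by nra.
rewrite pmulr_rge0// subr_ge0 => h.
apply: le_trans (ler_norm _) _.
by rewrite -sqrtr_sqr /norm2 -sqrtrM ?dot_ge0// ler_wsqrtr.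
Qed.

Lemma norm2D x y : norm2 (x + y) <= norm2 x + norm2 y.
Proof.
rewrite -(ler_pXn2r (ltn0Sn 1)) ?nnegrE ?addr_ge0 ?norm2_ge0//.
rewrite sqr_norm2 dotDl !dotDr (dotC y x) sqrrD !sqr_norm2.
by have := dot_le_norm2 x y; lra.
Qed.

Lemma norm1D x y : norm1 (x + y) <= norm1 x + norm1 y.
Proof.
by rewrite /norm1 -big_split; apply: ler_sum => i _; rewrite mxE ler_normD.
Qed.

Lemma norm2_le_norm1 x : norm2 x <= norm1 x.
Proof.
rewrite -(ler_pXn2r (ltn0Sn 1)) ?nnegrE ?norm1_ge0 ?norm2_ge0//.
rewrite sqr_norm2 expr2 {1}/norm1 mulr_suml; apply: ler_sum => i _.
rewrite -expr2 -real_normK ?num_real// expr2 ler_wpM2l//.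
by rewrite /norm1 (bigD1 i)//= lerDl sumr_ge0.
Qed.

Lemma norm1_gt0 x : x != 0 -> 0 < norm1 x.
Proof. by rewrite -norm2_gt0 => /lt_le_trans; apply; exact: norm2_le_norm1. Qed.

Lemma norm1_eq0 x : (norm1 x == 0) = (x == 0).
Proof.
have [->|x0] := eqVneq x 0; last by rewrite gt_eqF// norm1_gt0.
by rewrite norm1_0 eqxx.
Qed.

Lemma norm1_le_norm2 x : norm1 x <= Num.sqrt n%:R * norm2 x.
Proof.
pose y : 'rV[R]_n := \row_i `|x 0 i|; pose e : 'rV[R]_n := const_mx 1.
have -> : norm1 x = dot e y by apply: eq_bigr => i _; rewrite !mxE mul1r.
have -> : norm2 x = norm2 y.
  congr (Num.sqrt _); apply: eq_bigr => i _.
  by rewrite !mxE -!expr2 real_normK ?num_real.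
have -> : Num.sqrt n%:R = norm2 e; last exact: dot_le_norm2.
congr (Num.sqrt _); rewrite /dot (eq_bigr (fun=> 1)) => [|i _].
  by rewrite sumr_const card_ord.
by rewrite !mxE mulr1.
Qed.

End Norms.

Lemma norm1_row_mx (R : rcfType) p q (u : 'rV[R]_p) (v : 'rV[R]_q) :
  norm1 (row_mx u v) = norm1 u + norm1 v.
Proof.
rewrite /norm1 big_split_ord /=.
by congr (_ + _); apply: eq_bigr => i _; rewrite (row_mxEl, row_mxEr).
Qed.

Lemma dot_row_mx (R : rcfType) p q (u u' : 'rV[R]_p) (v v' : 'rV[R]_q) :
  dot (row_mx u v) (row_mx u' v') = dot u u' + dot v v'.
Proof.
rewrite /dot big_split_ord /=.
by congr (_ + _); apply: eq_bigr => i _; rewrite !(row_mxEl, row_mxEr).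
Qed.

Section MinimalSupport.
Context {R : realType} {m n : nat}.
Variable V : 'M[R]_(m, n).
Implicit Types (x y u v : 'rV[R]_n).

Definition supp x : {set 'I_n} := [set i | x 0 i != 0]%SET.

Definition support_minimal x :=
  [/\ (x <= V)%MS, x != 0 &
      forall y, (y <= V)%MS -> (supp y \proper supp x)%SET -> y = 0].

Lemma sub_linear x y c : (x <= V)%MS -> (y <= V)%MS -> ((x + c *: y)%R <= V)%MS.
Proof. by move=> xV yV; rewrite addmx_sub// scalemx_sub. Qed.

(* Take the largest step in direction - y along which no coordinate of x changes
   sign: it makes a coordinate vanish. *)
Lemma shrink_support x y : (supp y \subset supp x)%SET ->
    (exists i, 0 < x 0 i * y 0 i) ->
  exists2 c, 0 < c & (supp (x - c *: y) \proper supp x)%SET /\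
    forall i, 0 <= (x - c *: y) 0 i * x 0 i.
Proof.
move=> syx [i0 i0P].
case: (Order.TotalTheory.arg_minP (fun i => x 0 i / y 0 i)
  (P := fun i => 0 < x 0 i * y 0 i) i0P) => i iP imin.
have yi0 : y 0 i != 0 by apply: contraTneq iP => ->; rewrite mulr0 ltxx.
have c0 : 0 < x 0 i / y 0 i.
  have -> : x 0 i / y 0 i = (x 0 i * y 0 i) * (y 0 i)^-1 ^+ 2 by field.
  by rewrite mulr_gt0// exprn_even_gt0//= invr_eq0.
exists (x 0 i / y 0 i) => //; split.
  rewrite properE; apply/andP; split.
    apply/fintype.subsetP => j; rewrite !inE !mxE; apply: contraNneq => xj0.
    have : j \notin supp y.
      by apply: contra (fintype.subsetP syx j) _; rewrite inE xj0 eqxx.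
    by rewrite inE negbK => /eqP ->; rewrite xj0 mulr0 subr0.
  apply/fintype.subsetPn; exists i; rewrite !inE.
    by apply: contraTneq iP => ->; rewrite mul0r ltxx.
  by rewrite !mxE divfK// subrr eqxx.
move=> j; rewrite !mxE mulrBl subr_ge0.
have [yxj|yxj] := leP (x 0 j * y 0 j) 0.
  rewrite -mulrA (mulrC (y 0 j)); apply: (@le_trans _ _ 0).
    by rewrite pmulr_rle0.
  by rewrite -expr2 sqr_ge0.
have yj0 : y 0 j != 0 by apply: contraTneq yxj => ->; rewrite mulr0 ltxx.
rewrite -mulrA (mulrC (y 0 j)).
apply: (@le_trans _ _ (x 0 j / y 0 j * (x 0 j * y 0 j))).
  by rewrite ler_wpM2r ?(ltW yxj)// imin.
by rewrite le_eqVlt; apply/orP; left; apply/eqP; field.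
Qed.

(** If the products x_i y_i take both signs, shrinking along y and along -y gives x - c y and x + d
    y, and x is their convex combination with weights d / (c + d) and c / (c + d). If they have one
    sign, c y (or its analogue for -y) is itself a summand. They cannot all vanish, since y is
    nonzero and supported in the support of x. *)
Lemma conformal_split x y : (x <= V)%MS -> (y <= V)%MS -> y != 0 ->
    (supp y \proper supp x)%SET ->
  exists u v, [/\ (u <= V)%MS /\ (v <= V)%MS, (supp u \proper supp x)%SET,
    (supp v \proper supp x)%SET, x = u + v &
    forall i, 0 <= u 0 i * x 0 i /\ 0 <= v 0 i * x 0 i].
Proof.
move=> xV.
have half z : (z <= V)%MS -> (supp z \proper supp x)%SET ->
    (exists i, 0 < x 0 i * z 0 i) -> (forall i, 0 <= x 0 i * z 0 i) ->
  exists u v, [/\ (u <= V)%MS /\ (v <= V)%MS, (supp u \proper supp x)%SET,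
    (supp v \proper supp x)%SET, x = u + v &
    forall i, 0 <= u 0 i * x 0 i /\ 0 <= v 0 i * x 0 i].
  move=> zV zx /(shrink_support (proper_sub zx))[c c0 [cs cx]] xz.
  exists (x - c *: z), (c *: z); split => //.
  - by rewrite -scaleNr sub_linear// scalemx_sub.
  - apply: sub_proper_trans zx; apply/fintype.subsetP => i; rewrite !inE mxE.
    by rewrite mulf_eq0 negb_or => /andP[].
  - by rewrite subrK.
  - by move=> i; split=> //; rewrite mxE -mulrA mulr_ge0 ?(ltW c0)// mulrC.
move=> yV y0 yx.
have sN z : supp (- z) = supp z by apply/setP => i; rewrite !inE mxE oppr_eq0.
have [/existsP[i ip]|/existsPn pos] := boolP [exists i, 0 < x 0 i * y 0 i];
  have [/existsP[j jn]|/existsPn neg] := boolP [exists i, x 0 i * y 0 i < 0].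
- have [|c c0 [cs cx]] := shrink_support (proper_sub yx); first by exists i.
  have [||d d0 [ds dx]] := @shrink_support x (- y).
  + by rewrite sN (proper_sub yx).
  + by exists j; rewrite mxE mulrN oppr_gt0.
  have cd : 0 < c + d by rewrite addr_gt0.
  exists ((d / (c + d)) *: (x - c *: y)), ((c / (c + d)) *: (x - d *: - y)).
  have sZ t z : (supp (t *: z) \subset supp z)%SET.
    by apply/fintype.subsetP => l; rewrite !inE mxE mulf_eq0 negb_or => /andP[].
  split; [split | | | | ].
  + by rewrite scalemx_sub// -scaleNr sub_linear.
  + by rewrite scalemx_sub// -scaleNr scalerN -scaleNr opprK sub_linear.
  + exact: sub_proper_trans cs.
  + exact: sub_proper_trans ds.
  + by apply/rowP => l; rewrite !mxE; field; rewrite gt_eqF.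
  + move=> l; split; rewrite mxE -[leRHS]mulrA.
      by rewrite mulr_ge0// divr_ge0// ltW.
    by rewrite mulr_ge0// divr_ge0// ltW.
- apply: (half y) => //; first by exists i.
  by move=> l; rewrite leNgt.
- apply: (half (- y)); rewrite ?sN//.
  + by rewrite -scaleN1r scalemx_sub.
  + by exists j; rewrite mxE mulrN oppr_gt0.
  + by move=> l; rewrite mxE mulrN oppr_ge0 leNgt.
- suff : y = 0 by move=> y0'; rewrite y0' eqxx in y0.
  apply/rowP => l; rewrite mxE; apply/eqP/negPn/negP => yl.
  have xl : x 0 l != 0.
    by have := fintype.subsetP (proper_sub yx) l; rewrite !inE => /(_ yl).
  have /eqP : x 0 l * y 0 l = 0.
    by apply/le_anti; rewrite !leNgt pos neg.
  by rewrite mulf_eq0 (negPf xl) (negPf yl).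
Qed.

Lemma norm2_le_from_minimal M :
    (forall x, support_minimal x -> norm2 x <= M * norm1 x) ->
  forall x, (x <= V)%MS -> norm2 x <= M * norm1 x.
Proof.
move=> Mmin x; have [s] := ubnP #|supp x|; elim: s x => // s IH x xs xV.
have [->|x0] := eqVneq x 0.
  by rewrite norm2_0 norm1_0 mulr0.
have [/Mmin//|] := pselect (support_minimal x).
move=> nmin; have [y [yV yx y0]] : exists y, [/\ (y <= V)%MS,
    (supp y \proper supp x)%SET & y != 0].
  apply: contrapT => ny; apply: nmin; split=> // y yV yx.
  by apply: contrapT => /eqP y0; apply: ny; exists y.
have [u [v [[uV vV] us vs xuv con]]] := conformal_split xV yV y0 yx.
have n1 : norm1 x = norm1 u + norm1 v.
  rewrite /norm1 -big_split; apply: eq_bigr => i _ /=.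
  have := con i; rewrite {1 2 3}xuv mxE.
  have [xi0|xi0|xi0] := ltgtP (x 0 i) 0; rewrite xuv mxE in xi0.
  - by rewrite !nmulr_lge0// => -[ui vi]; rewrite !ler0_norm ?opprD//; lra.
  - by rewrite !pmulr_lge0// => -[ui vi]; rewrite !ger0_norm//; lra.
  - move=> _.
    (* Where x vanishes the sign condition is empty; only the inclusion of supports makes u and v
       vanish there. *)
    have z w : (supp w \proper supp x)%SET -> w 0 i = 0.
      move=> /proper_sub/fintype.subsetP/(_ i); rewrite !inE xuv mxE xi0 eqxx.
      by case: eqP => // _ /(_ isT).
    by rewrite !z// !(addr0, normr0).
rewrite n1 mulrDr {1}xuv; apply: le_trans (norm2D _ _) _.
apply: lerD; apply: IH => //.
  exact: leq_trans (proper_card us) xs.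
exact: leq_trans (proper_card vs) xs.
Qed.

End MinimalSupport.

(** * Minors *)

Section Image.
Context {n k : nat}.
Implicit Type f : 'I_n -> 'I_k.

Definition im f : {set 'I_k} := [set f i | i in 'I_n]%SET.

Lemma imP f j : reflect (exists i, j = f i) (j \in im f).
Proof.
by apply: (iffP imsetP) => [[i _ ->]|[i ->]]; exists i.
Qed.

Lemma imf f i : f i \in im f.
Proof. by apply/imP; exists i. Qed.

End Image.

Lemma im_enum_val k (P : {set 'I_k}) : im (@enum_val _ (mem P)) = P.
Proof.
apply/setP => i; apply/imP/idP => [[j ->]|iP]; first exact: enum_valP.
by exists (enum_rank_in iP i); rewrite enum_rankK_in.
Qed.

Section Minors.
Context {R : realType} {k : nat}.
Variable B : 'M[R]_k.

(** Two enumerations of a set differ by a permutation, which changes a determinant only by a sign.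
    Absolute minors thus depend on the sets alone, and any convenient enumeration may replace
    [enum_val]. *)
Lemma absdet_mxsub n (f1 f2 g1 g2 : 'I_n -> 'I_k) :
    injective f1 -> injective g1 ->
    im f1 = im f2 -> im g1 = im g2 ->
  `|\det (mxsub f1 g1 B)| = `|\det (mxsub f2 g2 B)|.
Proof.
have reindex (h1 h2 : 'I_n -> 'I_k) : injective h1 ->
    im h1 = im h2 -> exists s : 'S_n, forall i, h1 i = h2 (s i).
  move=> h1I h12; have /fin_all_exists[s sP] i : exists j, h1 i = h2 j.
    by apply/imP; rewrite -h12 imf.
  have sI : injective s by move=> i j sij; apply: h1I; rewrite !sP sij.
  by exists (perm sI) => i; rewrite permE.
move=> f1I g1I /(reindex _ _ f1I)[s sP] /(reindex _ _ g1I)[t tP].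
have -> : mxsub f1 g1 B = row_perm s (col_perm t (mxsub f2 g2 B)).
  by apply/matrixP => i j; rewrite !mxE sP tP.
rewrite row_permE col_permE !det_mulmx !det_perm !normrM !normrX !normrN1.
by rewrite !expr1n mul1r mulr1.
Qed.

Lemma abs_subdetE n (f g : 'I_n -> 'I_k) : injective f -> injective g ->
  `|subdet B (im f) (im g)| = `|\det (mxsub f g B)|.
Proof.
move=> fI gI; rewrite /subdet /submatrix.
have card (h : 'I_n -> 'I_k) : injective h -> #|im h| = n.
  by move=> hI; rewrite card_imset// card_ord.
(* The dimensions are generalized to variables so that substitution removes the cast hidden in
   [conform_mx]. *)
have conform m p (f0 : 'I_m -> 'I_k) (g0 : 'I_p -> 'I_k) : m = n -> p = n ->
    injective f0 -> injective g0 ->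
    im f0 = im f -> im g0 = im g ->
    `|\det (conform_mx (0 : 'M_m) (mxsub f0 g0 B))| = `|\det (mxsub f g B)|.
  move=> em ep; subst m; subst p => f0I g0I f0f g0g.
  by rewrite conform_mx_id; apply: absdet_mxsub.
by apply: conform; rewrite ?card ?im_enum_val//; apply: enum_val_inj.
Qed.

Section MinorVector.
Context {l : nat}.
Variables (f : 'I_l.+1 -> 'I_k) (g : 'I_l -> 'I_k).
Hypotheses (fI : injective f) (gI : injective g).

(* The column j is put in front, in order to expand along it. *)
Definition border (j : 'I_k) (t : 'I_l.+1) : 'I_k := oapp g j (unlift ord0 t).

(* The vector in the left kernel of D = B_{P,S} given by Cramer's rule, where f
   and g enumerate P and S. *)
Definition minor_vec : 'rV[R]_k :=
  \sum_(i < l.+1) ((-1) ^+ i * \det (mxsub (f \o lift i) g B)) *: delta_mx 0 (f i).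

(** The cofactors along the front column do not involve that column, so it may be arbitrary: a
    column of B below, and later the vector a itself. *)
Lemma expand_bordered (w : 'I_l.+1 -> R) (A : 'M_l.+1) :
    (forall i, A i ord0 = w i) ->
    (forall i t, A i (lift ord0 t) = B (f i) (g t)) ->
  \det A = \sum_(i < l.+1) (-1) ^+ i * \det (mxsub (f \o lift i) g B) * w i.
Proof.
move=> A0 At; rewrite (expand_det_col _ ord0); apply: eq_bigr => i _.
rewrite A0 mulrC /cofactor addn0; congr (_ * \det _ * _).
by apply/matrixP => s t; rewrite !mxE At.
Qed.

Lemma minor_vecE (t : 'I_l.+1) :
  minor_vec 0 (f t) = (-1) ^+ t * \det (mxsub (f \o lift t) g B).
Proof.
rewrite summxE (bigD1 t)//= !mxE !eqxx mulr1 big1 ?addr0// => i it.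
by rewrite !mxE (inj_eq fI) eq_sym (negPf it) mulr0.
Qed.

Lemma minor_vec_mulE j : (minor_vec *m B) 0 j = \det (mxsub f (border j) B).
Proof.
rewrite (@expand_bordered (fun i => B (f i) j)) => [|i|i t].
- rewrite mulmx_suml summxE; apply: eq_bigr => i _.
  by rewrite -scalemxAl -rowE !mxE.
- by rewrite mxE /border unlift_none.
- by rewrite mxE /border liftK.
Qed.

Lemma abs_minor_vec i : `|minor_vec 0 i| =
  if i \in (im f)
  then `|subdet B (im f :\ i)%SET (im g)| else 0.
Proof.
case: imP => [[t ->]|inf].
  rewrite minor_vecE normrM normrX normrN1 expr1n mul1r.
  rewrite -abs_subdetE//; last exact: inj_comp fI lift_inj.
  congr (`|subdet _ _ _|); apply/setP => j; rewrite !inE.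
  apply/imP/andP => [[s ->]|[jt /imP[s js]]].
    by rewrite /= (inj_eq fI) eq_sym neq_lift imf.
  rewrite js (inj_eq fI) eq_sym in jt.
  by have [s' ss'] := unlift_some jt; exists s' => //; rewrite js ss'.
rewrite summxE big1 ?normr0// => t _; rewrite !mxE eqxx /=.
have [ift|] := eqVneq i (f t); last by rewrite mulr0.
by case: inf; exists t.
Qed.

Lemma abs_minor_vec_mul j : `|(minor_vec *m B) 0 j| =
  if j \in (im g) then 0
  else `|subdet B (im f) (j |: im g)%SET|.
Proof.
rewrite minor_vec_mulE; case: imP => [[t ->]|jng].
  rewrite -det_tr (determinant_alternate (neq_lift ord0 t)) ?normr0// => i.
  by rewrite !mxE /border unlift_none liftK.
have bI : injective (border j).
  move=> s t; rewrite /border; case: unliftP => [s' ->|->];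
    case: unliftP => [t' ->|->] //=.
  - by move=> /gI ->.
  - by move=> jg; case: jng; exists s'.
  - by move=> jg; case: jng; exists t'.
rewrite -abs_subdetE//; congr (`|subdet _ _ _|).
apply/setP => i; rewrite !inE; apply/imP/orP => [[t ->]|].
  rewrite /border; case: unliftP => [s _|_]; last by left.
  by right; rewrite imf.
case=> [/eqP ->|/imP[t ->]].
  by exists ord0; rewrite /border unlift_none.
by exists (lift ord0 t); rewrite /border liftK.
Qed.

End MinorVector.

(* The vector a [sqrt k I_k, B]; for a = minor_vec its l1 and l2 norms are
   Delta_1 and Delta_2. *)
Definition graph_vec (a : 'rV[R]_k) : 'rV[R]_(k + k) :=
  row_mx (Num.sqrt k%:R *: a) (a *m B).

Lemma norm1_graph_vec a :
  norm1 (graph_vec a) = Num.sqrt k%:R * norm1 a + norm1 (a *m B).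
Proof. by rewrite norm1_row_mx norm1Z ger0_norm ?sqrtr_ge0. Qed.

Lemma dot_graph_vec a :
  dot (graph_vec a) (graph_vec a) = k%:R * dot a a + dot (a *m B) (a *m B).
Proof. by rewrite dot_row_mx dotZl dotZr mulrA -expr2 sqr_sqrtr. Qed.

Lemma graph_vecZ c a : graph_vec (c *: a) = c *: graph_vec a.
Proof. by rewrite /graph_vec scale_row_mx -scalemxAl !scalerA mulrC. Qed.

(** The minor vector vanishes outside P and its image vanishes on S, so the full sums reduce to
    those in [Delta]; this uses $0^p = 0$, which fails for p = 0. *)
Lemma Delta_minor_vec l (f : 'I_l.+1 -> 'I_k) (g : 'I_l -> 'I_k) p :
    injective f -> injective g -> p != 0 ->
  Delta p B (im f) (im g) =
  (k%:R `^ (p / 2) * \sum_i `|minor_vec f g 0 i| `^ p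
   + \sum_j `|(minor_vec f g *m B) 0 j| `^ p) `^ p^-1.
Proof.
move=> fI gI p0; rewrite /Delta; congr ((_ * _ + _) `^ _).
- rewrite big_mkcond; apply: eq_bigr => i _; rewrite abs_minor_vec//.
  by case: ifP => // _; rewrite powR0.
- rewrite big_mkcond; apply: eq_bigr => i _; rewrite abs_minor_vec_mul// inE.
  by case: (i \in im g); rewrite //= powR0.
Qed.

Lemma Delta1_minor_vec l (f : 'I_l.+1 -> 'I_k) (g : 'I_l -> 'I_k) :
    injective f -> injective g ->
  Delta 1 B (im f) (im g) = norm1 (graph_vec (minor_vec f g)).
Proof.
move=> fI gI; rewrite Delta_minor_vec ?oner_eq0// norm1_graph_vec invr1 div1r.
rewrite powR12_sqrt//; under eq_bigr do rewrite powRr1//.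
under [X in _ + X]eq_bigr do rewrite powRr1//.
by rewrite powRr1// addr_ge0 ?mulr_ge0 ?sqrtr_ge0 ?norm1_ge0.
Qed.

Lemma Delta2_minor_vec l (f : 'I_l.+1 -> 'I_k) (g : 'I_l -> 'I_k) :
    injective f -> injective g ->
  Delta 2 B (im f) (im g) = norm2 (graph_vec (minor_vec f g)).
Proof.
have sq m (x : 'rV[R]_m) : \sum_i `|x 0 i| `^ 2 = dot x x.
  by apply: eq_bigr => i _; rewrite powR_mulrn// real_normK ?num_real ?expr2.
move=> fI gI; rewrite Delta_minor_vec ?pnatr_eq0// !sq divff ?pnatr_eq0//.
rewrite powRr1// -dot_graph_vec powR12_sqrt ?dot_ge0//.
Qed.

End Minors.

(** * Vectors of minimal support in E are multiples of minor vectors *)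

Section MinimalGraphVectors.
Context {R : realType} {k : nat}.
Variable B : 'M[R]_k.
Hypothesis k_gt0 : (0 < k)%N.

Local Notation V := (row_mx (Num.sqrt k%:R)%:M B : 'M[R]_(k, k + k)).

Lemma sqrtk_gt0 : 0 < Num.sqrt k%:R :> R.
Proof. by rewrite sqrtr_gt0 ltr0n. Qed.

Lemma sub_graphP x : (x <= V)%MS <-> exists a, x = graph_vec B a.
Proof.
split=> [/submxP[a ->]|[a ->]]; last first.
  by apply/submxP; exists a; rewrite mul_mx_row mul_mx_scalar.
by exists a; rewrite mul_mx_row mul_mx_scalar.
Qed.

Lemma graph_vec_eq0 a : (graph_vec B a == 0) = (a == 0).
Proof.
apply/eqP/eqP => [|->]; last by rewrite -[0](scale0r 0) graph_vecZ scale0r.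
rewrite -row_mx0 => /eq_row_mx[/eqP + _].
by rewrite scaler_eq0 gt_eqF ?sqrtk_gt0// => /eqP.
Qed.

Lemma graph_vecB a b : graph_vec B (a - b) = graph_vec B a - graph_vec B b.
Proof. by rewrite /graph_vec opp_row_mx add_row_mx scalerBr mulmxBl. Qed.

Lemma colsub_mulmx n p (f : 'I_n -> 'I_k) (h : 'I_p -> 'I_k) (b : 'rV[R]_k) :
    injective f -> (forall i, i \notin im f -> b 0 i = 0) ->
  colsub h (b *m B) = colsub f b *m mxsub f h B.
Proof.
move=> fI b0; apply/rowP => j; rewrite !mxE.
rewrite (bigID (mem (im f)))/= addrC big1 => [|i /b0 ->]; last by rewrite mul0r.
rewrite add0r big_imset/=; last by move=> s t _ _ /fI.
by apply: eq_bigr => t _; rewrite !mxE.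
Qed.

Definition extend_vec n (f : 'I_n -> 'I_k) (v : 'rV[R]_n) : 'rV[R]_k :=
  \sum_t v 0 t *: delta_mx 0 (f t).

Lemma colsub_extend n (f : 'I_n -> 'I_k) v :
  injective f -> colsub f (extend_vec f v) = v.
Proof.
move=> fI; apply/rowP => t; rewrite mxE summxE (bigD1 t)//= big1 => [|s st].
  by rewrite !mxE !eqxx mulr1 addr0.
by rewrite !mxE (inj_eq fI) eq_sym (negPf st) mulr0.
Qed.

Lemma extend_vec_out n (f : 'I_n -> 'I_k) v i :
  i \notin im f -> extend_vec f v 0 i = 0.
Proof.
move=> /imP fi; rewrite summxE big1// => t _; rewrite !mxE eqxx /=.
by have [it|] := eqVneq i (f t); [case: fi; exists t | rewrite mulr0].
Qed.

Lemma minor_vec_extend l (f : 'I_l.+1 -> 'I_k) (g : 'I_l -> 'I_k) :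
  minor_vec B f g =
  extend_vec f (\row_(i < l.+1) ((-1) ^+ i * \det (mxsub (f \o lift i) g B))).
Proof. by apply: eq_bigr => i _; rewrite mxE. Qed.

(** Subtracting from b the multiple of a that agrees with it at a nonzero coordinate of a leaves an
    element of the span with properly smaller support, hence 0. *)
Lemma minimal_line (a b : 'rV[R]_k) : support_minimal V (graph_vec B a) ->
    (forall i, a 0 i = 0 -> b 0 i = 0) ->
    (forall j, (a *m B) 0 j = 0 -> (b *m B) 0 j = 0) ->
  exists c, b = c *: a.
Proof.
move=> [_]; rewrite graph_vec_eq0 => a0 amin ba bBa.
have [i ai] : exists i, a 0 i != 0.
  apply/existsP; apply: contraNT a0 => /existsPn na.
  by apply/eqP/rowP => i; rewrite mxE; have /negPn/eqP := na i.
exists (b 0 i / a 0 i); apply/eqP; rewrite -subr_eq0 -graph_vec_eq0; apply/eqP.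
apply: amin; first by apply/sub_graphP; eexists.
rewrite graph_vecB graph_vecZ properE; apply/andP; split.
  apply/fintype.subsetP => t; rewrite !inE; apply: contraNneq.
  rewrite !mxE; case: splitP => s _; rewrite !(mxE, mulf_eq0).
    move=> /eqP; rewrite mulf_eq0 gt_eqF ?sqrtk_gt0//= => /eqP as0.
    by rewrite ba// as0 !mulr0 subr0.
  move=> as0; have := bBa s; rewrite !mxE => -> //.
  by rewrite as0 mulr0 subr0.
apply/subsetPn; exists (lshift k i); rewrite !inE.
  by rewrite row_mxEl mxE mulf_neq0// gt_eqF ?sqrtk_gt0.
by rewrite negbK -graph_vecZ -graph_vecB row_mxEl !mxE; apply/eqP; field.
Qed.

(* If the kernel of D = B_{P,S} is spanned by a, bordering D with a gives an
   invertible matrix, so the maximal minors of D do not all vanish. *)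
Lemma minimal_minor_vec a : support_minimal V (graph_vec B a) ->
  exists l (f : 'I_l.+1 -> 'I_k) (g : 'I_l -> 'I_k) (c : R),
    [/\ injective f, injective g, c != 0 & minor_vec B f g = c *: a].
Proof.
move=> amin; have [_] := amin; rewrite graph_vec_eq0 => a0 _.
pose P := supp a; pose f0 := @enum_val _ (mem P).
have f0I : injective f0 by exact: enum_val_inj.
(* Z collects the coordinates where a B vanishes. By minimality, a is up to scalars the only vector
   supported on P whose image vanishes on Z. *)
pose Z := (~: supp (a *m B))%SET; pose h := @enum_val _ (mem Z).
pose Dz := mxsub f0 h B.
have imh j : (a *m B) 0 j = 0 -> exists t, j = h t.
  by move=> aBj; apply/imP; rewrite im_enum_val !inE aBj eqxx.
have kerDz (b : 'rV[R]_k) : (forall i, i \notin im f0 -> b 0 i = 0) ->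
    (forall t, (b *m B) 0 (h t) = 0) -> exists c, b = c *: a.
  move=> bP bZ; apply: minimal_line => // [i ai|j /imh[t ->]//].
  by apply: bP; rewrite im_enum_val inE ai eqxx.
have aout i : i \notin im f0 -> a 0 i = 0.
  by rewrite im_enum_val inE negbK => /eqP.
pose a' := colsub f0 a.
have a'0 : a' != 0.
  apply: contraNneq a0 => a'0; apply/eqP/rowP => i; rewrite [RHS]mxE.
  have [/imP[t ->]|/aout//] := boolP (i \in im f0).
  by have := congr1 (fun v : 'rV_ _ => v 0 t) a'0; rewrite !mxE.
have a'Dz : a' *m Dz = 0.
  rewrite -colsub_mulmx//; apply/rowP => t; rewrite mxE [RHS]mxE.
  have : h t \in Z by exact: enum_valP.
  by rewrite !inE negbK => /eqP.
have rker : \rank (kermx Dz) = 1%N.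
  apply/eqP; rewrite eqn_leq; apply/andP; split; last first.
    have <- : \rank a' = 1%N by rewrite rank_rV a'0.
    by apply: mxrankS; apply/sub_kermxP.
  apply: leq_trans (rank_leq_row a'); apply: mxrankS.
  apply/row_subP => i; set v := row i _.
  have vD : v *m Dz = 0 by apply/sub_kermxP; exact: row_sub.
  have [||c vc] := kerDz (extend_vec f0 v).
  - by move=> j; apply: extend_vec_out.
  - move=> t; have /rowP/(_ t) := colsub_mulmx h f0I (@extend_vec_out _ f0 v).
    by rewrite colsub_extend// vD !mxE.
  - rewrite -(colsub_extend v f0I) vc; apply/submxP; exists c%:M.
    by rewrite mul_scalar_mx; apply/rowP => t; rewrite !mxE.
(* The columns in Z may be too many. As the left kernel of [Dz] is a line, its rank is |P| - 1; a
   maximal independent set of its columns gives a D of the required shape with the same left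
   kernel. *)
pose A := Dz^T; pose q := \rank A.
have e : q.+1 = #|P|.
  have := mxrank_ker Dz; rewrite rker -(mxrank_tr Dz) -/A -/q => e.
  have := rank_leq_col A; rewrite -/q => qP.
  by apply/esym/eqP; rewrite -(subnK qP) -e.
pose f := f0 \o cast_ord e; pose g := h \o maxrankfun A.
have fI : injective f by apply: inj_comp f0I (@cast_ord_inj _ _ e).
have gI : injective g by apply: inj_comp (@enum_val_inj _ _) (@maxrankfun_inj _ _ _ A).
have imf0 : im f = im f0.
  apply/setP => i; apply/imP/imP => -[t ->]; first by exists (cast_ord e t).
  by exists (cast_ord (esym e) t); rewrite /f /= cast_ordKV.
have kerD (b : 'rV[R]_k) : (forall i, i \notin im f0 -> b 0 i = 0) ->
    (forall t, (b *m B) 0 (g t) = 0) -> exists c, b = c *: a.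
  move=> bP bg; apply: kerDz => // t.
  have /submxP[E AE] : (A <= rowsub (maxrankfun A) A)%MS.
    by rewrite (eq_maxrowsub A).
  have := colsub_mulmx h f0I bP; rewrite -/Dz => /rowP/(_ t); rewrite mxE => ->.
  rewrite -(trmxK Dz) -/A AE trmx_mul mulmxA.
  have -> : colsub f0 b *m (rowsub (maxrankfun A) A)^T = 0.
    rewrite -[RHS](_ : colsub g (b *m B) = 0); last first.
      by apply/rowP => s; rewrite mxE bg mxE.
    rewrite (@colsub_mulmx _ _ f0)//; congr (_ *m _).
    by apply/matrixP => i j; rewrite !mxE.
  by rewrite mul0mx mxE.
have [||c mvc] := kerD (minor_vec B f g).
- by move=> i; rewrite -imf0 => iP; rewrite minor_vec_extend extend_vec_out.
- move=> t; apply/eqP; rewrite -normr_eq0 abs_minor_vec_mul// imf.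
  by rewrite eqxx.
exists q, f, g, c; split=> //; apply: contraNneq a0 => c0.
(* If c = 0, all maximal minors of D vanish and D bordered by a is singular. A vector of its left
   kernel also kills D, so it is d a; the front column then gives d <a, a> = 0, a contradiction. *)
pose M : 'M[R]_q.+1 :=
  \matrix_(i, t) oapp (fun s => B (f i) (g s)) (a 0 (f i)) (unlift ord0 t).
have : \det M == 0.
  rewrite (@expand_bordered _ _ B _ f g (fun i => a 0 (f i))).
  - apply/eqP/big1 => i _; rewrite -minor_vecE// mvc c0 scale0r mxE mul0r//.
  - by move=> i; rewrite mxE unlift_none.
  - by move=> i t; rewrite mxE liftK.
move=> /det0P[v v0 vM].
have [||d vd] := kerD (extend_vec f v).
- by move=> i; rewrite -imf0 => iP; rewrite extend_vec_out.
- move=> t; have /rowP/(_ t) := colsub_mulmx g fI (@extend_vec_out _ f v).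
  rewrite colsub_extend// mxE => ->.
  have /rowP/(_ (lift ord0 t)) := vM; rewrite !mxE => vMt; rewrite -[RHS]vMt.
  by apply: eq_bigr => i _; rewrite !mxE liftK.
have va : v = d *: colsub f a.
  by rewrite -(colsub_extend v fI) vd; apply/rowP => i; rewrite !mxE.
have /rowP/(_ ord0) := vM; rewrite !mxE va.
rewrite (eq_bigr (fun i => d * (colsub f a 0 i * colsub f a 0 i))); last first.
  by move=> i _; rewrite !mxE unlift_none /= mulrA.
rewrite -mulr_sumr => /eqP; rewrite mulf_eq0 [X in _ || X]dot_eq0.
case/orP => [/eqP d0|/eqP fa0]; first by rewrite va d0 scale0r eqxx in v0.
by rewrite va fa0 scaler0 eqxx in v0.
Qed.

End MinimalGraphVectors.

Section MaxDeltaRatio.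
Context {R : realType} {k : nat}.
Variable B : 'M[R]_k.

Lemma max_Delta_ratio_ge0 : 0 <= max_Delta_ratio B.
Proof. exact: bigmax_ge_id. Qed.

Lemma norm2_minor_vec_le l (f : 'I_l.+1 -> 'I_k) (g : 'I_l -> 'I_k) :
    injective f -> injective g -> (0 < l)%N ->
  norm2 (graph_vec B (minor_vec B f g)) <=
  max_Delta_ratio B * norm1 (graph_vec B (minor_vec B f g)).
Proof.
move=> fI gI l0; set x := graph_vec B _.
have [x0|x0] := eqVneq x 0.
  by rewrite x0 norm2_0 norm1_0 mulr0.
rewrite -ler_pdivrMr ?norm1_gt0// -Delta1_minor_vec// -Delta2_minor_vec//.
have cardim n (h : 'I_n -> 'I_k) : injective h -> #|im h| = n.
  by move=> hI; rewrite card_imset// card_ord.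
have lk : (l < k)%N by rewrite -(cardim _ f fI) -[X in (_ <= X)%N]card_ord max_card.
have lr : l \in index_iota 1 k by rewrite mem_index_iota l0 lk.
apply: (le_trans _ (le_bigmax_seq _ l xpredT _ lr isT)).
apply: (bigmax_sup (im f)); first by rewrite cardim.
apply: (bigmax_sup (im g)) => //.
by rewrite cardim// eqxx Delta1_minor_vec// norm1_eq0.
Qed.


(** Every admissible pair (P, S) yields a minor vector, hence a vector of E; this is the direction
    that the random construction relies on. *)
Lemma max_Delta_ratio_le M : 0 <= M ->
    (forall a, norm2 (graph_vec B a) <= M * norm1 (graph_vec B a)) ->
  max_Delta_ratio B <= M.
Proof.
move=> M0 le_M; apply: bigmax_le => // l _; apply: bigmax_le => // P /eqP Pl.
apply: bigmax_le => // S /andP[/eqP Sl].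
have enum (n : nat) (T : {set 'I_k}) : #|T| = n ->
    exists2 h : 'I_n -> 'I_k, injective h & T = im h.
  move=> Tn; exists (fun i => enum_val (cast_ord (esym Tn) i)).
    by move=> i j /enum_val_inj/cast_ord_inj.
  apply/setP => i; apply/idP/imP => [iT|[t ->]]; last exact: enum_valP.
  by exists (cast_ord Tn (enum_rank_in iT i)); rewrite cast_ordK enum_rankK_in.
have [f fI ->] := enum _ _ Pl; have [g gI ->] := enum _ _ Sl.
rewrite Delta1_minor_vec// Delta2_minor_vec// norm1_eq0 => x0.
by rewrite ler_pdivrMr ?norm1_gt0.
Qed.

Lemma minor_vec0 (f : 'I_1 -> 'I_k) (g : 'I_0 -> 'I_k) :
  minor_vec B f g = delta_mx 0 (f ord0).
Proof. by rewrite /minor_vec big_ord1 det_mx00 mulr1 scale1r. Qed.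

Section PairOfRows.
Variables (i0 i1 j : 'I_k).
Hypothesis i01 : i0 != i1.

Definition pair_fun (t : 'I_2) : 'I_k := if t == ord0 then i0 else i1.

Lemma pair_fun_inj : injective pair_fun.
Proof.
move=> [[|[|//]] s] [[|[|//]] t]; rewrite /pair_fun /= => /eqP.
- by move=> _; apply: val_inj.
- by rewrite (negPf i01).
- by rewrite eq_sym (negPf i01).
- by move=> _; apply: val_inj.
Qed.

Lemma minor_vec_pair : minor_vec B pair_fun (fun _ : 'I_1 => j) =
  B i1 j *: delta_mx 0 i0 - B i0 j *: delta_mx 0 i1.
Proof.
rewrite /minor_vec big_ord_recl big_ord1 !det_mx11 !mxE /=.
by rewrite expr0 mul1r expr1 mulN1r scaleNr.
Qed.

End PairOfRows.

End MaxDeltaRatio.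

(** * Single rows and pairs of rows of a sign matrix *)

Section SignMatrix.
Context {R : realType} {k : nat}.
Variable B : 'M[R]_k.
Hypothesis signB : sign_matrix B.

Lemma norm_sign i j : `|B i j| = 1.
Proof. by have [->|->] := signB i j; rewrite ?normrN1 ?normr1. Qed.

Lemma sqr_sign i j : B i j ^+ 2 = 1.
Proof. by rewrite -[_ ^+ 2]real_normK ?num_real// norm_sign expr1n. Qed.

Lemma norm1_graph_delta i :
  norm1 (graph_vec B (delta_mx 0 i)) = Num.sqrt k%:R + k%:R.
Proof.
rewrite norm1_graph_vec -rowE [norm1 (row _ _)](eq_bigr (fun=> 1)).
  rewrite sumr_const card_ord /norm1 (bigD1 i)//= big1.
    by rewrite addr0 mxE !eqxx normr1 mulr1.
  by move=> t ti; rewrite mxE eqxx (negPf ti) normr0.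
by move=> j _; rewrite mxE norm_sign.
Qed.

Lemma dot_graph_delta i :
  dot (graph_vec B (delta_mx 0 i)) (graph_vec B (delta_mx 0 i)) = 2 * k%:R.
Proof.
rewrite dot_graph_vec -rowE [dot (row _ _) _](eq_bigr (fun=> 1)).
  rewrite sumr_const card_ord /dot (bigD1 i)//= big1.
    by rewrite addr0 mxE !eqxx !mulr1 mulr_natl mulr2n.
  by move=> t ti; rewrite mxE eqxx (negPf ti) mul0r.
by move=> j _; rewrite mxE -expr2 sqr_sign.
Qed.

(** The coordinate B i1 j * B i0 t - B i0 j * B i1 t is 0 if the product of the two rows has the
    same value at t as at j, and 2 or -2 otherwise. Both norms therefore depend only on the number m
    of disagreements. *)
Lemma pair_vec_norms i0 i1 j (m := #|[set t | B i0 t * B i1 t != B i0 j * B i1 j]%SET|)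
    (x := graph_vec B (B i1 j *: delta_mx 0 i0 - B i0 j *: delta_mx 0 i1)) :
    i0 != i1 ->
  norm1 x = 2 * Num.sqrt k%:R + 2 * m%:R /\ dot x x = 2 * k%:R + 4 * m%:R.
Proof.
move=> i01; rewrite {}/x; set a := _ - _.
have a_in i : a 0 i = if i == i0 then B i1 j else if i == i1 then - B i0 j else 0.
  rewrite !mxE /=; have [->|ii0] := eqVneq i i0.
    by rewrite (negPf i01) mulr1 mulr0 subr0.
  by case: eqP => _; rewrite ?mulr1 ?mulr0 ?sub0r ?oppr0.
have sum_a (F : R -> R) : F 0 = 0 -> \sum_i F (a 0 i) = F (B i1 j) + F (- B i0 j).
  move=> F0; rewrite (bigD1 i0)//= (bigD1 i1) 1?eq_sym//= big1 => [|i /andP[]].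
    by rewrite addr0 !a_in !eqxx eq_sym (negPf i01).
  by move=> ii0 ii1; rewrite a_in (negPf ii0) (negPf ii1).
have aB t : `|(a *m B) 0 t| =
    2 * (t \in [set t | B i0 t * B i1 t != B i0 j * B i1 j]%SET)%:R.
  rewrite mulmxBl -!scalemxAl -!rowE !mxE inE.
  have n2 : `|-1 - 1 : R| = 2 by rewrite -opprD normrN ger0_norm ?addr_ge0 ?ler01.
  have n2' : `|1 + 1 : R| = 2 by rewrite ger0_norm ?addr_ge0 ?ler01.
  have h : (-1 == 1 :> R) = false by rewrite lt_eqF//; lra.
  by case: (signB i0 t) => ->; case: (signB i1 t) => ->;
     case: (signB i0 j) => ->; case: (signB i1 j) => ->;
     rewrite !(mulr1, mul1r, mulrN1, opprK, subrr, addNr, n2, n2', normr0, eqxx, h)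
             ?(eq_sym 1) ?h /= ?mulr0 ?mulr1.
have sum_m c : \sum_(t < k) c * (t \in [set t | B i0 t * B i1 t != B i0 j * B i1 j]%SET)%:R
    = c * m%:R :> R.
  rewrite -mulr_sumr -natr_sum /m -sum1_card; congr (_ * _%:R).
  by rewrite [RHS]big_mkcond; apply: eq_bigr => t _; case: (_ \in _).
split.
  rewrite norm1_graph_vec [norm1 a](sum_a (fun x => `|x|)) ?normr0//.
  rewrite normrN !norm_sign [norm1 _](eq_bigr _ (fun t _ => aB t)) sum_m; ring.
rewrite dot_graph_vec [dot a a](sum_a (fun x => x * x)) ?mul0r//.
rewrite mulrNN -!expr2 !sqr_sign; congr (_ + _); first by ring.
rewrite -(sum_m 4); apply: eq_bigr => t _; rewrite -expr2 -real_normK ?num_real//.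
by rewrite aB; case: (_ \in _) => /=; ring.
Qed.

(* With D empty (l = 0), a single row gives a vector of minimal support too; the
   statement only allows l > 0. Such a vector is beaten by l = 1: take j where
   the product of the two rows has its majority sign. *)
Lemma delta_le_pair i0 i1 : i0 != i1 -> (1 < k)%N -> exists j,
  let y := graph_vec B (delta_mx 0 i0) in
  let x := graph_vec B (B i1 j *: delta_mx 0 i0 - B i0 j *: delta_mx 0 i1) in
  norm2 y * norm1 x <= norm2 x * norm1 y.
Proof.
move=> i01 k1; pose s t := B i0 t * B i1 t.
have [j mj] : exists j, (#|[set t | s t != s j]%SET|.*2 <= k)%N.
  pose T := [set t | s t == 1]%SET; have := cardsC T; rewrite card_ord => TC.
  have s1 t : s t = 1 \/ s t = -1.
    rewrite /s; case: (signB i0 t) => ->; case: (signB i1 t) => ->;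
      rewrite ?mulrN1 ?mulr1 ?opprK; by [left | right].
  have h : (-1 == 1 :> R) = false by rewrite lt_eqF//; lra.
  have [TT|TT] := leqP (#|~: T|%SET).*2 k.
    have /card_gt0P[j] : (0 < #|T|)%N by rewrite lt0n; apply/eqP => T0; lia.
    rewrite inE => /eqP sj; exists j; rewrite sj (_ : [set t | _]%SET = ~: T)%SET//.
    by apply/setP => t; rewrite !inE.
  have /card_gt0P[j] : (0 < #|~: T|%SET)%N by rewrite lt0n; apply/eqP => T0; lia.
  rewrite !inE; case: (s1 j) => sj; rewrite sj ?eqxx// => _; exists j.
  rewrite sj (_ : [set t | _]%SET = T)%SET; first by lia.
  by apply/setP => t; rewrite !inE; case: (s1 t) => ->; rewrite ?eqxx ?h // eq_sym h.
exists j; have [nx dx] := pair_vec_norms j i01; move: mj nx dx; rewrite /s /=.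
set m := #|_|; set x := graph_vec B (_ - _) => mj nx dx.
set y := graph_vec B _.
have nn (u v : 'rV[R]_(k + k)) : 0 <= norm2 u * norm1 v.
  by rewrite mulr_ge0 ?norm1_ge0 ?norm2_ge0.
rewrite -(ler_pXn2r (ltn0Sn 1)) ?nnegrE ?nn// !exprMn !sqr_norm2 dx nx.
rewrite dot_graph_delta norm1_graph_delta.
have : m%:R * 2 <= k%:R :> R by rewrite -natrM ler_nat muln2.
have : 2 <= k%:R :> R by rewrite ler_nat.
have : 0 <= m%:R :> R by [].
have : 0 <= Num.sqrt k%:R :> R by rewrite sqrtr_ge0.
have : k%:R = Num.sqrt k%:R ^+ 2 :> R by rewrite sqr_sqrtr.
set q := Num.sqrt _; move: q (m%:R : R) (k%:R : R) => q {nx dx mj}{}m K -> q0 m0 q2 mq.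
have q1 : 1 <= q.
  by rewrite leNgt; apply/negP => q1; have : q ^+ 2 < 1 by [rewrite expr_lt1]; lra.
(* After division by 2 q^2 the squared inequality is [main], and the difference of its sides is
   exactly twice [mK] plus [lin] plus [qq]. The last term needs k >= 2; for k = 2 and m = 1 there is
   equality. *)
have mK : 0 <= m * (q ^+ 2 - m * 2) by rewrite mulr_ge0// subr_ge0.
have lin : 0 <= (q ^+ 2 - m * 2) * (2 * q - 1) by rewrite mulr_ge0; lra.
have qq : 0 <= q ^+ 2 * (q ^+ 2 - 2) by rewrite mulr_ge0 ?sqr_ge0// subr_ge0.
have main : 4 * (q + m) ^+ 2 <= (q ^+ 2 + 2 * m) * (1 + q) ^+ 2 by nra.
have -> : 2 * q ^+ 2 * (2 * q + 2 * m) ^+ 2 = 2 * q ^+ 2 * (4 * (q + m) ^+ 2) by ring.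
have -> : (2 * q ^+ 2 + 4 * m) * (q + q ^+ 2) ^+ 2 =
  2 * q ^+ 2 * ((q ^+ 2 + 2 * m) * (1 + q) ^+ 2) by ring.
by rewrite ler_wpM2l// mulr_ge0// sqr_ge0.
Qed.

End SignMatrix.

(** * The distortion of the span and of its orthogonal complement *)

Section NormDistortion.
Context {R : realType}.

Lemma avg_norm1 n (x : 'rV[R]_n) : avg_norm 1 x = n%:R^-1 * norm1 x.
Proof.
rewrite /avg_norm invr1; under eq_bigr do rewrite powRr1//.
by rewrite powRr1// mulr_ge0 ?invr_ge0 ?ler0n ?norm1_ge0.
Qed.

Lemma avg_norm2 n (x : 'rV[R]_n) : avg_norm 2 x = (Num.sqrt n%:R)^-1 * norm2 x.
Proof.
rewrite /avg_norm (eq_bigr (fun i => x 0 i * x 0 i)) => [|i _]; last first.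
  by rewrite powR_mulrn// real_normK ?num_real ?expr2.
rewrite powR12_sqrt ?mulr_ge0 ?invr_ge0 ?ler0n ?dot_ge0//.
by rewrite sqrtrM ?invr_ge0 ?ler0n// sqrtrV ?ler0n.
Qed.

Lemma avg_norm_ratio n (x : 'rV[R]_n) :
  avg_norm 2 x / avg_norm 1 x = Num.sqrt n%:R * (norm2 x / norm1 x).
Proof.
rewrite avg_norm1 avg_norm2 invfM invrK.
have [n0|n0] := posnP n; first by subst n; rewrite sqrtr0 invr0 !mul0r.
have q0 : Num.sqrt n%:R != 0 :> R by rewrite gt_eqF// sqrtr_gt0 ltr0n.
have -> : n%:R = Num.sqrt n%:R ^+ 2 :> R by rewrite sqr_sqrtr.
rewrite sqrtr_sqr ger0_norm ?sqrtr_ge0//.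
by move: (norm1 x)^-1 => r; field.
Qed.

End NormDistortion.

Section GraphDistortion.
Context {R : realType} {k : nat}.
Variable B : 'M[R]_k.
Hypotheses (k_gt1 : (1 < k)%N) (signB : sign_matrix B).

Let k_gt0 : (0 < k)%N. Proof. exact: ltnW. Qed.

Lemma norm2_graph_le x : sqrtI_span B x -> norm2 x <= max_Delta_ratio B * norm1 x.
Proof.
move: x; apply: norm2_le_from_minimal => x xmin.
have [a xa] : exists a, x = graph_vec B a by apply/sub_graphP; case: xmin.
subst x.
have [l [f [g [c [fI gI c0 mvc]]]]] := minimal_minor_vec k_gt0 xmin.
suff : norm2 (graph_vec B (minor_vec B f g)) <=
    max_Delta_ratio B * norm1 (graph_vec B (minor_vec B f g)).
  rewrite mvc graph_vecZ norm2Z norm1Z mulrCA ler_pM2l// normr_gt0//.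
have [l0|] := posnP l; last exact: norm2_minor_vec_le.
subst l; rewrite minor_vec0; set i0 := f ord0.
have [i1 i01] : exists i1, i0 != i1.
  have : (0 < #|[set~ i0]%SET|)%N by rewrite cardsC1 card_ord; lia.
  by move=> /card_gt0P[i1]; rewrite !inE eq_sym; exists i1.
have [j /=] := delta_le_pair signB i01 k_gt1.
set y := graph_vec B _; set x := graph_vec B _ => yx.
have x0 : 0 < norm1 x.
  have [-> _] := pair_vec_norms signB j i01.
  by rewrite ltr_wpDr ?mulr_ge0 ?mulr_gt0 ?sqrtk_gt0.
have := norm2_minor_vec_le B (pair_fun_inj i01) (g := fun _ : 'I_1 => j).
rewrite minor_vec_pair => /(_ _ isT) xM.
rewrite -(ler_pM2r x0); apply: (le_trans yx).
rewrite mulrAC ler_wpM2r ?norm1_ge0//; apply: xM.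
by move=> s t _; rewrite !ord1.
Qed.

Lemma norm_distortion_graph :
  norm_distortion (sqrtI_span B) = Num.sqrt (2 * k%:R) * max_Delta_ratio B.
Proof.
have sq : Num.sqrt (k + k)%:R = Num.sqrt (2 * k%:R) :> R.
  by rewrite -natrM mul2n addnn.
have s0 : 0 < Num.sqrt (2 * k%:R) :> R by rewrite sqrtr_gt0 mulr_gt0// ltr0n.
have ub : ubound [set avg_norm 2 x / avg_norm 1 x | x in
    sqrtI_span B `&` [set x | x != 0]] (Num.sqrt (2 * k%:R) * max_Delta_ratio B).
  move=> _ [x [xE /= x0] <-]; rewrite avg_norm_ratio sq ler_wpM2l ?(ltW s0)//.
  by rewrite ler_pdivrMr ?norm1_gt0// norm2_graph_le.
have ne : [set avg_norm 2 x / avg_norm 1 x | x in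
    sqrtI_span B `&` [set x | x != 0]] !=set0.
  pose i := Ordinal k_gt0; pose x := graph_vec B (delta_mx 0 i).
  exists (avg_norm 2 x / avg_norm 1 x), x => //; split.
    by apply/sub_graphP; eexists.
  rewrite /= graph_vec_eq0//; apply/eqP => /rowP/(_ i)/eqP.
  by rewrite !mxE !eqxx oner_eq0.
apply/le_anti/andP; split; first exact: ge_sup.
rewrite mulrC -ler_pdivlMr//; apply: max_Delta_ratio_le => [|a].
  rewrite divr_ge0 ?(ltW s0)//; have [r rE] := ne.
  apply: le_trans (sup_upper_bound _ rE); last by split; [|eexists; exact: ub].
  case: rE => x _ <-; rewrite avg_norm_ratio.
  by rewrite mulr_ge0 ?sqrtr_ge0// divr_ge0 ?norm1_ge0 ?norm2_ge0.
have [->|a0] := eqVneq (graph_vec B a) 0.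
  by rewrite norm2_0 norm1_0 mulr0.
rewrite -ler_pdivrMr ?norm1_gt0// ler_pdivlMr// mulrC -sq -avg_norm_ratio.
apply: sup_upper_bound; first by split=> //; eexists; exact: ub.
by exists (graph_vec B a) => //; split=> //; apply/sub_graphP; eexists.
Qed.

End GraphDistortion.

Lemma sign_matrix_tr (R : realType) k (B : 'M[R]_k) :
  sign_matrix B -> sign_matrix B^T.
Proof. by move=> signB i j; rewrite mxE. Qed.

(** * Exchange of the two halves *)

Section OrthogonalComplement.
Context {R : realType} {k : nat}.
Variable B : 'M[R]_k.
Hypothesis k_gt0 : (0 < k)%N.

Definition swap_vec (x : 'rV[R]_(k + k)) : 'rV[R]_(k + k) :=
  row_mx (rsubmx x) (- lsubmx x).

Lemma norm1_swap x : norm1 (swap_vec x) = norm1 x.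
Proof.
rewrite -{2}(hsubmxK x) !norm1_row_mx -scaleN1r norm1Z normrN1 mul1r.
exact: addrC.
Qed.

Lemma norm2_swap x : norm2 (swap_vec x) = norm2 x.
Proof.
rewrite /norm2 -{3 4}(hsubmxK x) !dot_row_mx -scaleN1r dotZl dotZr !mulN1r opprK.
by rewrite addrC.
Qed.

Lemma avg_ratio_swap x :
  avg_norm 2 (swap_vec x) / avg_norm 1 (swap_vec x) = avg_norm 2 x / avg_norm 1 x.
Proof. by rewrite !avg_norm1 !avg_norm2 norm1_swap norm2_swap. Qed.

Lemma swap_vecK x : swap_vec (swap_vec x) = - x.
Proof.
by rewrite /swap_vec row_mxKl row_mxKr -opp_row_mx hsubmxK.
Qed.

Lemma orth_complP x : orth_compl (sqrtI_span B) x <->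
  Num.sqrt k%:R *: lsubmx x = - (rsubmx x *m B^T).
Proof.
have dotE a : \sum_i graph_vec B a 0 i * x 0 i =
    dot a (Num.sqrt k%:R *: lsubmx x + rsubmx x *m B^T).
  rewrite -[LHS]/(dot _ _) -{1}(hsubmxK x) dot_row_mx dotZl dotDr dotZr.
  congr (_ + _); rewrite /dot; under eq_bigr do rewrite mxE mulr_suml.
  rewrite exchange_big; apply: eq_bigr => i _ /=.
  rewrite [in RHS]mxE mulr_sumr; apply: eq_bigr => j _.
  by rewrite [B^T j i]mxE; ring.
split=> [xE|xE y /sub_graphP[a ->]].
  (* The vector x is tested against x(a) with a equal to the defect of the equation, which turns
     orthogonality into <a, a> = 0. *)
  apply/eqP; rewrite -addr_eq0 -dot_eq0 -dotE; apply/eqP/xE.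
  by apply/sub_graphP; eexists.
by rewrite dotE xE addNr /dot big1// => i _; rewrite mxE mulr0.
Qed.

Lemma swap_orth_compl x :
  sqrtI_span B^T (swap_vec x) <-> orth_compl (sqrtI_span B) x.
Proof.
have q0 := sqrtk_gt0 (R := R) k_gt0.
split.
  move=> /sub_graphP[a /eq_row_mx[xr xl]]; apply/orth_complP.
  by rewrite xr -scalemxAl -xl scalerN opprK.
move=> /orth_complP xE; apply/sub_graphP.
exists ((Num.sqrt k%:R)^-1 *: rsubmx x); congr row_mx.
  by rewrite scalerA mulfV ?gt_eqF// scale1r.
by rewrite -scalemxAl -[_ *m _]opprK -xE scalerN scalerA mulVf ?gt_eqF// scale1r.
Qed.

Lemma norm_distortion_orth_compl :
  norm_distortion (orth_compl (sqrtI_span B)) = norm_distortion (sqrtI_span B^T).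
Proof.
congr sup; apply/seteqP; split => _ [x [xE /= x0] <-].
  exists (swap_vec x); last exact: avg_ratio_swap.
  split; first by apply/swap_orth_compl.
  by rewrite /= -norm2_eq0 norm2_swap norm2_eq0.
exists (swap_vec x); last exact: avg_ratio_swap.
split; last by rewrite /= -norm2_eq0 norm2_swap norm2_eq0.
apply/swap_orth_compl; rewrite swap_vecK /sqrtI_span /row_span /=.
by rewrite -scaleN1r scalemx_sub.
Qed.

End OrthogonalComplement.

Lemma Delta_bound_eq (R : realType) k (B : 'M[R]_k) :
    (1 < k)%N -> sign_matrix B ->
  Delta_bound B = Num.max (norm_distortion (sqrtI_span B))
                          (norm_distortion (orth_compl (sqrtI_span B))).
Proof.
move=> k1 signB; rewrite norm_distortion_orth_compl ?(ltnW k1)//.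
rewrite !norm_distortion_graph//; last exact: sign_matrix_tr.
by rewrite /Delta_bound maxr_pMr// sqrtr_ge0.
Qed.

(** * Exponential moments of random signs *)

Section ExponentialInequalities.
Context {R : realType}.
Implicit Types x y : R.

Lemma expR_le_inv x : x < 1 -> expR x <= (1 - x)^-1.
Proof.
move=> x1; have x0 : 0 < 1 - x by rewrite subr_gt0.
by rewrite -[x in leLHS]opprK expRN lef_pV2 ?posrE ?expR_gt0// expR_ge1Dx.
Qed.

(** The subgaussian bound for one random sign, with the constant 2 in place of the optimal 1/2, so
    that 1 + x <= e^x is enough. For x^2 <= 1/2 the sum is at most 2 / (1 - x^2); for larger x^2
    already |x| <= 2 x^2. *)
Lemma expR_cosh_le x : expR x + expR (- x) <= 2 * expR (2 * x ^+ 2).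
Proof.
have [x2|x2] := leP (x ^+ 2) (2^-1); last first.
  have : expR x <= expR (2 * x ^+ 2) by rewrite ler_expR; nra.
  have : expR (- x) <= expR (2 * x ^+ 2) by rewrite ler_expR; nra.
  by lra.
have x1 : x < 1 by nra.
have xN1 : - x < 1 by nra.
have := expR_le_inv x1; have := expR_le_inv xN1.
have := expR_ge1Dx (2 * x ^+ 2).
suff : (1 - x)^-1 + (1 - - x)^-1 <= 2 * (1 + 2 * x ^+ 2) by lra.
have -> : (1 - x)^-1 + (1 - - x)^-1 = 2 / (1 - x ^+ 2).
  by field; rewrite !gt_eqF //; nra.
by rewrite ler_pdivrMr; nra.
Qed.

(** The polynomial is (1 - y^2/2 + y^4/12)(1 + y)^2 - 1 divided by y/12; its sign is what
    [expR_quartic] needs. *)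
Lemma quartic_ge0 y : 0 <= y ->
  0 <= 24 + 6 * y - 12 * y ^+ 2 - 5 * y ^+ 3 + 2 * y ^+ 4 + y ^+ 5.
Proof.
move=> y0; pose t := y ^+ 2 - 5 / 2.
have -> : 24 + 6 * y - 12 * y ^+ 2 - 5 * y ^+ 3 + 2 * y ^+ 4 + y ^+ 5 =
  y * (t ^+ 2 - 4^-1) + 2 * (t - 2^-1) ^+ 2 + 6 by rewrite /t; field.
have [y2|y2] := leP y 2.
  have : 0 <= y * t ^+ 2 by rewrite mulr_ge0 ?sqr_ge0.
  have : 0 <= (t - 2^-1) ^+ 2 by rewrite sqr_ge0.
  by lra.
have t1 : 1 <= t by rewrite /t; nra.
have : 0 <= y * (t ^+ 2 - 4^-1) by rewrite mulr_ge0//; nra.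
have : 0 <= (t - 2^-1) ^+ 2 by rewrite sqr_ge0.
by lra.
Qed.

(** Only even powers appear on the right, so that for y = |rad a| with a unit vector a the moments 1
    and at most 3 give the mean 1 - 1/2 + 3/12 = 3/4. The proof only uses e^y >= 1 + y. *)
Lemma expR_quartic y : 0 <= y ->
  expR (- 2 * y) <= 1 - y ^+ 2 / 2 + y ^+ 4 / 12.
Proof.
move=> y0; rewrite mulNr expRN.
have y1 : 0 < 1 + y by lra.
have -> : expR (2 * y) = expR y ^+ 2 by rewrite -expRM_natl.
apply: (@le_trans _ _ ((1 + y) ^+ 2)^-1).
  rewrite lef_pV2 ?posrE ?exprn_gt0 ?expR_gt0//.
  by rewrite ler_pXn2r ?nnegrE ?expR_ge1Dx ?expR_ge0 ?(ltW y1).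
rewrite -[leLHS]mul1r ler_pdivrMr ?exprn_gt0// -subr_ge0.
have -> : (1 - y ^+ 2 / 2 + y ^+ 4 / 12) * (1 + y) ^+ 2 - 1 =
  12^-1 * (y * (24 + 6 * y - 12 * y ^+ 2 - 5 * y ^+ 3 + 2 * y ^+ 4 + y ^+ 5)).
  by field.
by rewrite mulr_ge0 ?invr_ge0 ?ler0n// mulr_ge0 ?quartic_ge0.
Qed.

End ExponentialInequalities.

(** * Finite averages and sums of random signs *)

Section Mean.
Context {R : realType}.

Definition mean (T : finType) (F : T -> R) : R := #|T|%:R^-1 * \sum_t F t.

Lemma eq_mean (T : finType) (F G : T -> R) : F =1 G -> mean F = mean G.
Proof. by move=> FG; rewrite /mean (eq_bigr _ (fun t _ => FG t)). Qed.

Lemma mean_le (T : finType) (F G : T -> R) :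
  (forall t, F t <= G t) -> mean F <= mean G.
Proof. by move=> FG; rewrite ler_wpM2l ?invr_ge0// ler_sum. Qed.

Lemma meanD (T : finType) (F G : T -> R) :
  mean (fun t => F t + G t) = mean F + mean G.
Proof. by rewrite /mean big_split mulrDr. Qed.

Lemma meanZ (T : finType) c (F : T -> R) : mean (fun t => c * F t) = c * mean F.
Proof. by rewrite /mean -mulr_sumr mulrCA. Qed.

Lemma mean_cst (T : finType) c : (0 < #|T|)%N -> mean (fun _ : T => c) = c.
Proof.
move=> T0; rewrite /mean sumr_const -[c *+ _]mulr_natl mulKf//.
by rewrite pnatr_eq0 -lt0n.
Qed.

Lemma mean_sum (T I : finType) (P : pred I) (F : I -> T -> R) :
  mean (fun t => \sum_(i | P i) F i t) = \sum_(i | P i) mean (F i).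
Proof. by rewrite /mean exchange_big mulr_sumr. Qed.

Lemma mean_reindex (T : finType) (h : T -> T) (F : T -> R) :
  injective h -> mean (fun t => F (h t)) = mean F.
Proof. by move=> hI; rewrite /mean [in RHS](reindex_inj hI). Qed.

Lemma exists_le_mean (T : finType) (F : T -> R) :
  (0 < #|T|)%N -> exists t, F t <= mean F.
Proof.
move=> T0; apply: contrapT => nF; have F_gt t : mean F < F t.
  by rewrite ltNge; apply/negP => Ft; apply: nF; exists t.
have : mean F < mean F; last by rewrite ltxx.
rewrite -{1}(mean_cst (mean F) T0) /mean ltr_pM2l ?invr_gt0 ?ltr0n//.
apply: ltr_sum => //; have /card_gt0P[t _] := T0.
by apply/hasP; exists t; rewrite ?mem_index_enum.
Qed.

(** Independence of the coordinates of a uniformly random function. *)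
Lemma mean_prod (I T : finType) (F : I -> T -> R) :
  mean (fun f : {ffun I -> T} => \prod_i F i (f i)) = \prod_i mean (F i).
Proof.
rewrite /mean -bigA_distr_bigA card_ffun natrX big_split prodr_const /=.
by rewrite exprVn.
Qed.

End Mean.

Section Rademacher.
Context {R : realType} {k : nat}.
Implicit Types (a b : 'rV[R]_k) (g : {ffun 'I_k -> bool}).

Lemma card_signs : (0 < #|{ffun 'I_k -> bool}|)%N.
Proof. by rewrite card_ffun card_bool expn_gt0. Qed.

Definition rad a g : R := \sum_i (-1) ^+ (g i) * a 0 i.

Definition flip (j : 'I_k) g : {ffun 'I_k -> bool} := [ffun i => g i (+) (i == j)].

Lemma flipK j : involutive (flip j).
Proof. by move=> g; apply/ffunP => i; rewrite !ffunE -addbA addbb addbF. Qed.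

Lemma mean_flip j (F : {ffun 'I_k -> bool} -> R) :
  mean F = mean (fun g => (F g + F (flip j g)) / 2).
Proof.
rewrite (eq_mean (fun g => mulrC _ 2^-1)) meanZ meanD.
by rewrite (mean_reindex F (inv_inj (flipK j))); field.
Qed.

(** Partial sums over a list allow induction. Averaging over the flip of the new sign removes the
    odd powers of its term x, leaving T^2 + x^2 and T^4 + 6 x^2 T^2 + x^4; the bound then follows
    from 3 t^2 + 6 x^2 t + x^4 <= 3 (t + x^2)^2. *)
Lemma rad_moments a (r : seq 'I_k) (S := fun g => \sum_(i <- r) (-1) ^+ (g i) * a 0 i)
    (s := \sum_(i <- r) a 0 i ^+ 2) : uniq r ->
  mean (fun g => S g ^+ 2) = s /\ mean (fun g => S g ^+ 4) <= 3 * s ^+ 2.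
Proof.
rewrite {}/S {}/s; elim: r => [_|j r IH /andP[jr /IH {IH}[]]].
  rewrite !big_nil; under eq_mean do rewrite big_nil expr0n.
  under [X in _ /\ X <= _]eq_mean do rewrite big_nil expr0n.
  by rewrite mean_cst ?card_signs// expr0n mulr0.
pose T g : R := \sum_(i <- r) (-1) ^+ (g i) * a 0 i; pose t := \sum_(i <- r) a 0 i ^+ 2.
rewrite -/t -[mean _]/(mean (fun g => T g ^+ 2)).
rewrite -[X in X <= _]/(mean (fun g => T g ^+ 4)) => m2 m4.
have t0 : 0 <= t by apply: sumr_ge0 => i _; rewrite sqr_ge0.
have Tflip g : T (flip j g) = T g.
  apply: eq_big_seq => i ir; rewrite ffunE.
  by case: eqP => [ij|_]; [rewrite -ij ir in jr | rewrite addbF].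
have eflip g : (-1) ^+ (flip j g j) = - (-1) ^+ (g j) :> R.
  by rewrite ffunE eqxx addbT signrN.
rewrite big_cons -/t; set x := a 0 j; split.
  rewrite (mean_flip j) (_ : mean _ = mean (fun g => T g ^+ 2 + x ^+ 2)).
    by rewrite meanD m2 mean_cst ?card_signs// addrC.
  apply: eq_mean => g; rewrite !big_cons -/(T _) -/(T _) Tflip eflip -/x.
  have := sqrr_sign R (g j); move: ((-1) ^+ _) => e e2.
  have -> : T g ^+ 2 + x ^+ 2 = T g ^+ 2 + e ^+ 2 * x ^+ 2 by rewrite e2 mul1r.
  by field.
rewrite (mean_flip j).
rewrite (_ : mean _ = mean (fun g => T g ^+ 4 + (6 * x ^+ 2 * T g ^+ 2 + x ^+ 4))).
  rewrite !meanD meanZ m2 mean_cst ?card_signs//.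
  have := sqr_ge0 (x ^+ 2); have := mulr_ge0 t0 (sqr_ge0 x).
  move: (mean _) t x m4 {m2 t0} => M t x *.
  have -> : 3 * (x ^+ 2 + t) ^+ 2 = 3 * t ^+ 2 + 6 * (t * x ^+ 2) + 3 * (x ^+ 2) ^+ 2.
    by ring.
  have -> : x ^+ 4 = (x ^+ 2) ^+ 2 by ring.
  by lra.
apply: eq_mean => g; rewrite !big_cons -/(T _) -/(T _) Tflip eflip -/x.
have := sqrr_sign R (g j); move: ((-1) ^+ _) => e e2.
have -> : 6 * x ^+ 2 * T g ^+ 2 + x ^+ 4 =
  6 * x ^+ 2 * e ^+ 2 * T g ^+ 2 + x ^+ 4 * (e ^+ 2) ^+ 2 by rewrite e2; ring.
by field.
Qed.

Lemma mean_rad2 a : mean (fun g => rad a g ^+ 2) = dot a a.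
Proof.
have [-> _] := rad_moments a (index_enum_uniq _).
by apply: eq_bigr => i _; rewrite expr2.
Qed.

Lemma mean_rad4 a : mean (fun g => rad a g ^+ 4) <= 3 * dot a a ^+ 2.
Proof.
have [_ /le_trans] := rad_moments a (index_enum_uniq _); apply.
by rewrite ler_pM2l// (eq_bigr (fun i => a 0 i * a 0 i)).
Qed.

Lemma mean_expR_abs_rad a : dot a a = 1 ->
  mean (fun g => expR (- 2 * `|rad a g|)) <= 3 / 4.
Proof.
move=> a1; pose F g := 1 + (- 2^-1 * rad a g ^+ 2 + 12^-1 * rad a g ^+ 4).
apply: (@le_trans _ _ (mean F)).
  apply: mean_le => g; apply: le_trans (expR_quartic (normr_ge0 _)) _.
  rewrite (exprM `|_| 2 2) real_normK ?num_real// -exprM /F.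
  by rewrite le_eqVlt; apply/orP; left; apply/eqP; field.
rewrite !meanD !meanZ mean_cst ?card_signs// mean_rad2 a1.
by have := mean_rad4 a; rewrite a1; lra.
Qed.

Lemma mean_expR_rad a : mean (fun g => expR (rad a g)) <= expR (2 * dot a a).
Proof.
rewrite (eq_mean (fun g => expR_sum _ _ _)).
rewrite (mean_prod (fun i (s : bool) => expR ((-1) ^+ s * a 0 i))).
rewrite mulr_sumr expR_sum; apply: ler_prod => i _; apply/andP; split.
  by rewrite mulr_ge0 ?invr_ge0// sumr_ge0// => b _; rewrite expR_ge0.
rewrite /mean card_bool big_bool /= expr1 expr0 mulN1r mul1r.
have := expR_cosh_le (a 0 i); rewrite expr2.
by lra.
Qed.

End Rademacher.

Section SignMatrices.
Context {R : realType} {k : nat}.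
Implicit Types (a b : 'rV[R]_k) (f : {ffun 'I_k -> {ffun 'I_k -> bool}}).

(** The signs are indexed by columns first, so that the coordinates of a B are independent copies of
    [rad a]. *)
Definition sign_mx f : 'M[R]_k := \matrix_(i, j) (-1) ^+ (f j i).

Definition tr_signs f : {ffun 'I_k -> {ffun 'I_k -> bool}} :=
  [ffun i => [ffun j => f j i]].

Lemma card_sign_matrices : (0 < #|{ffun 'I_k -> {ffun 'I_k -> bool}}|)%N.
Proof. by rewrite card_ffun expn_gt0 card_signs. Qed.

Lemma sign_mx_tr f : sign_mx (tr_signs f) = (sign_mx f)^T.
Proof. by apply/matrixP => i j; rewrite !mxE !ffunE. Qed.

Lemma mean_tr_signs (F : {ffun 'I_k -> {ffun 'I_k -> bool}} -> R) :
  mean (fun f => F (tr_signs f)) = mean F.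
Proof.
apply/mean_reindex/inv_inj => f.
by apply/ffunP => i; apply/ffunP => j; rewrite !ffunE.
Qed.

Lemma mul_sign_mx a f j : (a *m sign_mx f) 0 j = rad a (f j).
Proof. by rewrite mxE; apply: eq_bigr => i _; rewrite mxE mulrC. Qed.

Lemma mean_expR_norm1 a : dot a a = 1 ->
  mean (fun f => expR (- 2 * norm1 (a *m sign_mx f))) <= (3 / 4) ^+ k.
Proof.
move=> a1; have E f : expR (- 2 * norm1 (a *m sign_mx f)) =
    \prod_j expR (- 2 * `|rad a (f j)|).
  rewrite -expR_sum -mulr_sumr; congr (expR (_ * _)).
  by apply: eq_bigr => j _; rewrite mul_sign_mx.
rewrite (eq_mean E) (mean_prod (fun _ g => expR (- 2 * `|rad a g|))).
rewrite prodr_const card_ord lerXn2r ?nnegrE ?mean_expR_abs_rad//.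
  by rewrite mulr_ge0 ?invr_ge0// sumr_ge0// => b _; rewrite expR_ge0.
by rewrite divr_ge0.
Qed.

Lemma mean_expR_dot a b :
  mean (fun f => expR (dot (a *m sign_mx f) b)) <= expR (2 * (dot a a * dot b b)).
Proof.
have E f : expR (dot (a *m sign_mx f) b) = \prod_j expR (rad (b 0 j *: a) (f j)).
  rewrite -expR_sum; congr expR; apply: eq_bigr => j _.
  rewrite mul_sign_mx mulr_suml; apply: eq_bigr => i _.
  by rewrite mxE; ring.
rewrite (eq_mean E) (mean_prod (fun j g => expR (rad (b 0 j *: a) g))).
rewrite !mulr_sumr expR_sum; apply: ler_prod => j _; apply/andP; split.
  by rewrite mulr_ge0 ?invr_ge0// sumr_ge0// => g _; rewrite expR_ge0.
apply: le_trans (mean_expR_rad _) _; rewrite dotZl dotZr ler_expR.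
by rewrite le_eqVlt; apply/orP; left; apply/eqP; ring.
Qed.

End SignMatrices.

(** * Nets and the existence of good sign matrices *)

Section Grid.
Context {R : realType} {k L : nat}.
Implicit Type z : {ffun 'I_k -> 'I_L + 'I_L}.

(* The integers of absolute value at most L; as in [int], the second summand
   starts at -1, so that 0 is represented only once. *)
Definition grid_val (w : 'I_L + 'I_L) : R :=
  match w with inl n => n%:R | inr n => - n.+1%:R end.

Definition grid_abs (w : 'I_L + 'I_L) : nat :=
  match w with inl n => n | inr n => n.+1 end.

Definition grid_vec z : 'rV[R]_k := \row_i grid_val (z i).

Definition grid_size z : nat := (\sum_i grid_abs (z i))%N.

Lemma norm1_grid_vec z : norm1 (grid_vec z) = (grid_size z)%:R.
Proof.
rewrite natr_sum; apply: eq_bigr => i _; rewrite mxE /grid_val /grid_abs.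
by case: (z i) => n; rewrite ?normrN normr_nat.
Qed.

Lemma geom_sum_le (s : R) : 0 <= s < 1 -> \sum_(n < L) s ^+ n <= (1 - s)^-1.
Proof.
move=> /andP[s0 s1]; have s1' : 0 < 1 - s by rewrite subr_gt0.
rewrite -[leRHS]mul1r ler_pdivlMr// mulrC.
have -> : (1 - s) * \sum_(n < L) s ^+ n = 1 - s ^+ L.
  by rewrite -[LHS]opprK -mulNr opprB -subrX1 opprB.
by rewrite gerBl exprn_ge0.
Qed.

Lemma sum_grid_abs_le (s : R) : 0 <= s < 1 ->
  \sum_w s ^+ grid_abs w <= (1 + s) / (1 - s).
Proof.
move=> s01; have /andP[s0 s1] := s01; rewrite big_sumType /=.
under [X in _ + X]eq_bigr do rewrite exprS.
rewrite -mulr_sumr -{1}[X in X + _]mul1r -mulrDl ler_wpM2l ?addr_ge0//.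
exact: geom_sum_le.
Qed.

(** The sum factors over the coordinates. This generating function takes the place of a count of
    grid points, and its bound does not depend on the range L. *)
Lemma sum_grid_size_le (s : R) : 0 <= s < 1 ->
  \sum_z s ^+ grid_size z <= ((1 + s) / (1 - s)) ^+ k.
Proof.
move=> s01; have /andP[s0 s1] := s01.
rewrite (eq_bigr (fun z => \prod_i s ^+ grid_abs (z i))) => [|z _]; last first.
  by rewrite prodrXr.
rewrite -(bigA_distr_bigA (fun (_ : 'I_k) w => s ^+ grid_abs w)).
rewrite prodr_const card_ord lerXn2r ?nnegrE ?sum_grid_abs_le//.
  by apply: sumr_ge0 => w _; rewrite exprn_ge0.
by apply: divr_ge0; [rewrite addr_ge0 | rewrite subr_ge0 ltW].
Qed.

Lemma round_to_grid (t : R) : `|t| < L%:R ->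
  exists w, `|grid_val w| <= `|t| /\ `|t - grid_val w| <= 1.
Proof.
move=> tL; pose n := Num.truncn `|t|.
have /andP[nt tn] := truncn_itv (normr_ge0 t).
have nL : (n < L)%N by rewrite -(ltr_nat R) (le_lt_trans nt).
rewrite -natr1 in tn; rewrite -/n in nt tn.
have [t0|t0] := leP 0 t.
  exists (inl (Ordinal nL)); rewrite /= normr_nat; split=> //.
  by move: nt tn; rewrite ger0_norm// => *; rewrite ger0_norm; lra.
rewrite ltr0_norm// in nt tn.
case: n nL nt tn => [|m] mL nt tn.
  exists (inl (Ordinal mL)); rewrite /= normr_nat normr_ge0; split=> //.
  by rewrite subr0 ltr0_norm//; lra.
exists (inr (Ordinal (ltnW mL))); rewrite /= normrN normr_nat ltr0_norm//.
by split=> //; rewrite opprK ler_norml; apply/andP; split; lra.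
Qed.

End Grid.

Section GridNet.
Context {R : realType} {k : nat}.
Hypothesis k_gt0 : (0 < k)%N.
Implicit Types (a x : 'rV[R]_k).

Lemma norm2_mono a x : (forall i, `|x 0 i| <= `|a 0 i|) -> norm2 x <= norm2 a.
Proof.
move=> xa; apply: ler_wsqrtr; apply: ler_sum => i _.
rewrite -!expr2 -[leLHS]real_normK ?num_real// -[leRHS]real_normK ?num_real//.
by rewrite lerXn2r ?nnegrE.
Qed.

(** Each coordinate is rounded towards 0 with mesh 1 / (T sqrt k): k errors of at most one mesh give
    an l2 error of at most 1 / T, and rounding towards 0 increases neither norm. *)
Lemma grid_net L T a : (0 < T)%N -> (T * k < L)%N -> norm2 a <= 1 ->
  exists z : {ffun 'I_k -> 'I_L + 'I_L},
    let x := (T%:R * Num.sqrt k%:R)^-1 *: grid_vec z in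
    [/\ norm2 (a - x) <= T%:R^-1, norm2 x <= norm2 a
       & (grid_size z)%:R <= T%:R * Num.sqrt k%:R * norm1 a].
Proof.
move=> T0 TL a1; set M := T%:R * _.
have q0 : 0 < Num.sqrt k%:R :> R by rewrite sqrtr_gt0 ltr0n.
have M0 : 0 < M by rewrite mulr_gt0 ?ltr0n.
have /fin_all_exists[z zP] i : exists w : 'I_L + 'I_L,
    `|grid_val w| <= `|M * a 0 i| /\ `|M * a 0 i - grid_val w| <= 1.
  (* Since |a_i| <= 1 and sqrt k <= k, the scaled coordinate is at most T k < L; the range L only
     keeps the grid finite. *)
  apply: round_to_grid; apply: (@le_lt_trans _ _ (T * k)%:R); last by rewrite ltr_nat.
  have ai : `|a 0 i| <= 1.
    apply: le_trans a1; rewrite -sqrtr_sqr; apply: ler_wsqrtr.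
    rewrite /dot (bigD1 i)//= -expr2 lerDl sumr_ge0// => j _.
    by rewrite -expr2 sqr_ge0.
  rewrite normrM (gtr0_norm M0) -[leRHS]mulr1 ler_pM// ?(ltW M0)//.
  rewrite natrM ler_pM2l ?ltr0n// -[leRHS]sqr_sqrtr// expr2 ler_peMl ?(ltW q0)//.
  by rewrite -[leLHS]sqrtr1; apply: ler_wsqrtr; rewrite ler1n.
have zM i : `|M^-1 * grid_val (z i)| <= `|a 0 i|.
  rewrite normrM gtr0_norm ?invr_gt0// ler_pdivrMl//.
  by have [+ _] := zP i; rewrite normrM (gtr0_norm M0).
exists [ffun i => z i]; split.
- set d := a - _; have d_le i : `|d 0 i| <= M^-1.
    rewrite !mxE ffunE; have [_] := zP i.
    have -> : M * a 0 i - grid_val (z i) = M * (a 0 i - M^-1 * grid_val (z i)).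
      by rewrite mulrBr mulVKf// gt_eqF.
    by rewrite normrM gtr0_norm// -ler_pdivlMl// mulr1.
  rewrite -[T%:R^-1]ger0_norm ?invr_ge0// -sqrtr_sqr; apply: ler_wsqrtr.
  apply: (@le_trans _ _ (\sum_(i < k) M^-1 ^+ 2)).
    apply: ler_sum => i _; rewrite -expr2 -real_normK ?num_real//.
    by rewrite lerXn2r ?nnegrE ?invr_ge0 ?(ltW M0).
  rewrite sumr_const card_ord -[_ *+ k]mulr_natl /M invfM exprMn exprVn.
  rewrite [X in _ * (_ * X)]exprVn sqr_sqrtr// mulrCA mulfV ?mulr1 ?exprVn//.
  by rewrite pnatr_eq0 -lt0n.
- by apply: norm2_mono => i; rewrite !mxE ffunE.
- rewrite -norm1_grid_vec /norm1 mulr_sumr; apply: ler_sum => i _.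
  rewrite mxE ffunE; have [+ _] := zP i.
  by rewrite normrM (gtr0_norm M0).
Qed.

End GridNet.

Section Direction.
Context {R : realType} {n : nat}.
Implicit Type x : 'rV[R]_n.

Definition direction x : 'rV[R]_n := (norm2 x)^-1 *: x.

Lemma dot_direction x : x != 0 -> dot (direction x) (direction x) = 1.
Proof.
rewrite -norm2_eq0 => x0; rewrite dotZl dotZr -sqr_norm2.
by field.
Qed.

Lemma dot_direction_le1 x : dot (direction x) (direction x) <= 1.
Proof.
have [->|/dot_direction ->//] := eqVneq x 0.
by rewrite /direction scaler0 dot0l.
Qed.

Lemma directionK x : x = norm2 x *: direction x.
Proof.
have [->|x0] := eqVneq x 0; first by rewrite /direction !scaler0.
by rewrite scalerA mulfV ?scale1r// norm2_eq0.
Qed.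

End Direction.

(** The sum of the F_i / c_i has mean at most 3, so at some t it is at most 3, and so is each of its
    nonnegative terms. *)
Lemma exists_le_means (R : realType) (T : finType) (F1 F2 F3 : T -> R)
    (c1 c2 c3 : R) : (0 < #|T|)%N ->
    (forall t, 0 <= F1 t) -> (forall t, 0 <= F2 t) -> (forall t, 0 <= F3 t) ->
    0 < c1 -> 0 < c2 -> 0 < c3 ->
    mean F1 <= c1 -> mean F2 <= c2 -> mean F3 <= c3 ->
  exists t, [/\ F1 t <= 3 * c1, F2 t <= 3 * c2 & F3 t <= 3 * c3].
Proof.
move=> T0 F1_0 F2_0 F3_0 c1_0 c2_0 c3_0 m1 m2 m3.
have [t] := exists_le_mean
  (fun t => c1^-1 * F1 t + (c2^-1 * F2 t + c3^-1 * F3 t)) T0.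
rewrite !meanD !meanZ => tm.
have le1 (c m : R) : 0 < c -> m <= c -> c^-1 * m <= 1.
  by move=> c0 mc; rewrite ler_pdivrMl// mulr1.
have ge0 (c x : R) : 0 < c -> 0 <= x -> 0 <= c^-1 * x.
  by move=> c0 x0; rewrite mulr_ge0// invr_ge0 ltW.
have le3 (c x : R) : 0 < c -> c^-1 * x <= 3 -> x <= 3 * c.
  by move=> c0; rewrite ler_pdivrMl// mulrC.
have := le1 _ _ c1_0 m1; have := le1 _ _ c2_0 m2; have := le1 _ _ c3_0 m3.
have := ge0 _ _ c1_0 (F1_0 t); have := ge0 _ _ c2_0 (F2_0 t).
have := ge0 _ _ c3_0 (F3_0 t) => *.
by exists t; split; apply: le3 => //; lra.
Qed.

(** * Random signs satisfying all estimates on the grid *)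

Section GoodSigns.
Context {R : realType} {k : nat}.
Hypothesis k_gt0 : (0 < k)%N.
Implicit Types (a b : 'rV[R]_k) (f : {ffun 'I_k -> {ffun 'I_k -> bool}}).

(* Small enough for the weighted sum over the grid to be at most (20/19)^k, and
   such that grid points of size at most k / 120 have weight at least (19/20)^k. *)
Definition weight : R := (19 / 20) ^+ 120.

Lemma weight_bounds : 0 <= weight < 1 /\ (1 + weight) / (1 - weight) <= 20 / 19.
Proof.
have w5 : (19 / 20) ^+ 5 <= 4 / 5 :> R by lra.
(* The ratio is at most 20/19 as soon as the weight is at most 1/39. Here (19/20)^5 <= 4/5 and
   (4/5)^4 <= 1/2 give 2^-6. *)
have w : weight <= 64^-1.
  have -> : weight = ((19 / 20) ^+ 5) ^+ 24 by rewrite -exprM.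
  apply: (@le_trans _ _ ((4 / 5) ^+ 24)).
    by rewrite lerXn2r ?nnegrE ?exprn_ge0 ?divr_ge0.
  have -> : (4 / 5 : R) ^+ 24 = ((4 / 5) ^+ 4) ^+ 6 by rewrite -exprM.
  apply: (@le_trans _ _ ((2^-1) ^+ 6)); last by lra.
  by rewrite lerXn2r ?nnegrE ?exprn_ge0 ?divr_ge0 ?invr_ge0//; lra.
have w0 : 0 <= weight by rewrite exprn_ge0 ?divr_ge0.
split; first by apply/andP; split; lra.
by rewrite ler_pdivrMr; lra.
Qed.

Lemma weightX_ge0 n : 0 <= weight ^+ n.
Proof. by have [/andP[w0 _] _] := weight_bounds; rewrite exprn_ge0. Qed.

(* Bounding the mean of one exponentially weighted sum over the whole grid
   replaces the union bound over a net. *)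
Definition small_sum L f : R :=
  \sum_(z : {ffun 'I_k -> 'I_L + 'I_L} | grid_vec z != 0 :> 'rV[R]_k)
    weight ^+ grid_size z *
    expR (- 2 * norm1 (direction (grid_vec z) *m sign_mx f)).

(** The factor sqrt k brings the mean of each exponential to at most e^(2k), the exponential scale
    of the weighted grid sums; two points of size at most 4 k have joint weight at least 2^(-8k). *)
Definition op_sum L f : R :=
  \sum_(p : {ffun 'I_k -> 'I_L + 'I_L} * {ffun 'I_k -> 'I_L + 'I_L})
    2^-1 ^+ grid_size p.1 * 2^-1 ^+ grid_size p.2 *
    expR (dot (direction (grid_vec p.1) *m sign_mx f)
              (Num.sqrt k%:R *: direction (grid_vec p.2))).

Lemma mean_small_sum L : mean (small_sum L) <= (15 / 19) ^+ k.
Proof.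
have [/andP[w0 w1] w20] := weight_bounds.
rewrite mean_sum; under eq_bigr do rewrite meanZ.
apply: (@le_trans _ _ (\sum_(z : {ffun 'I_k -> 'I_L + 'I_L})
    weight ^+ grid_size z * (3 / 4) ^+ k)).
  rewrite big_mkcond; apply: ler_sum => z _; case: ifP => [z0|_].
    rewrite ler_wpM2l ?weightX_ge0//.
    by apply: mean_expR_norm1; rewrite dot_direction.
  by rewrite mulr_ge0 ?weightX_ge0 ?exprn_ge0 ?divr_ge0.
rewrite -mulr_suml.
apply: (@le_trans _ _ (((1 + weight) / (1 - weight)) ^+ k * (3 / 4) ^+ k)).
  by rewrite ler_wpM2r ?exprn_ge0 ?divr_ge0// sum_grid_size_le ?w0.
rewrite -exprMn lerXn2r ?nnegrE ?mulr_ge0 ?invr_ge0 ?subr_ge0 ?addr_ge0 ?ler01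
  ?(ltW w1)//.
by lra.
Qed.

Lemma mean_op_sum L : mean (op_sum L) <= (9 * expR 2) ^+ k.
Proof.
rewrite mean_sum; under eq_bigr do rewrite meanZ.
apply: (@le_trans _ _ (\sum_(p : {ffun 'I_k -> 'I_L + 'I_L} * {ffun 'I_k -> 'I_L + 'I_L})
    2^-1 ^+ grid_size p.1 * 2^-1 ^+ grid_size p.2 * expR 2 ^+ k)).
  apply: ler_sum => p _.
  rewrite ler_wpM2l ?mulr_ge0 ?exprn_ge0 ?invr_ge0//.
  apply: le_trans (mean_expR_dot _ _) _; rewrite -expRM_natr ler_expR.
  rewrite ler_pM2l// (dotZl (Num.sqrt _)) (dotZr (Num.sqrt _)) [X in _ * X]mulrA.
  rewrite -expr2 sqr_sqrtr//.
  rewrite mulrCA ler_piMr// mulr_ile1 ?dot_ge0 ?dot_direction_le1//.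
rewrite -mulr_suml -(pair_bigA _ (fun z w : {ffun 'I_k -> 'I_L + 'I_L} =>
  2^-1 ^+ grid_size z * 2^-1 ^+ grid_size w : R)) /=.
under eq_bigr do rewrite -mulr_sumr.
rewrite -mulr_suml exprMn ler_wpM2r ?exprn_ge0 ?expR_ge0//.
have h : \sum_(z : {ffun 'I_k -> 'I_L + 'I_L}) 2^-1 ^+ grid_size z <= 3 ^+ k :> R.
  apply: le_trans (sum_grid_size_le _) _; first by apply/andP; split; lra.
  by rewrite le_eqVlt; apply/orP; left; apply/eqP; congr (_ ^+ _); field.
have -> : 9 ^+ k = 3 ^+ k * 3 ^+ k :> R by rewrite -exprMn; congr (_ ^+ _); ring.
by apply: ler_pM => //; apply: sumr_ge0 => z _; rewrite exprn_ge0 ?invr_ge0.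
Qed.

(** The l1 lower bound does not pass to the transpose, so it is required for both matrices;
    transposing only permutes the sign choices, so the mean is the same. The operator norm bound
    does pass, and one sum suffices. *)
Lemma exists_good_signs L : exists f,
  [/\ small_sum L f <= 3 * (15 / 19) ^+ k,
      small_sum L (tr_signs f) <= 3 * (15 / 19) ^+ k
    & op_sum L f <= 3 * (9 * expR 2) ^+ k].
Proof.
have [/andP[w0 _] _] := weight_bounds.
have small_ge0 f : 0 <= small_sum L f.
  by apply: sumr_ge0 => z _; rewrite mulr_ge0 ?weightX_ge0 ?expR_ge0.
apply: (exists_le_means (card_sign_matrices (k := k)) small_ge0
  (fun f => small_ge0 (tr_signs f))).
- move=> f; apply: sumr_ge0 => p _.
  by rewrite !mulr_ge0 ?exprn_ge0 ?expR_ge0 ?invr_ge0.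
- by rewrite exprn_gt0 ?divr_gt0.
- by rewrite exprn_gt0 ?divr_gt0.
- by rewrite exprn_gt0 ?mulr_gt0 ?expR_gt0.
- exact: mean_small_sum.
- by rewrite (mean_tr_signs (small_sum L)) mean_small_sum.
- exact: mean_op_sum.
Qed.

Lemma op_sum_dot L f (z w : {ffun 'I_k -> 'I_L + 'I_L}) :
    op_sum L f <= 3 * (9 * expR 2) ^+ k ->
    (grid_size z <= 4 * k)%N -> (grid_size w <= 4 * k)%N ->
  dot (grid_vec z *m sign_mx f) (grid_vec w) <=
  16 * Num.sqrt k%:R * norm2 (grid_vec z : 'rV[R]_k) * norm2 (grid_vec w : 'rV[R]_k).
Proof.
move=> opf zk wk; set x := grid_vec z; set y := grid_vec w.
set u := direction x; set v := direction y; set q := Num.sqrt k%:R.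
have q0 : 0 < q by rewrite sqrtr_gt0 ltr0n.
have e2 : 2 <= expR 1 :> R by have := expR_ge1Dx (1 : R); lra.
have e0 := expR_gt0 (1 : R).
have eX n : expR n%:R = expR 1 ^+ n :> R by rewrite -expRM_natr mul1r.
have half n : (n <= 4 * k)%N -> 2^-1 ^+ (4 * k) <= 2^-1 ^+ n :> R.
  by move=> nk; rewrite ler_wiXn2l// ?invr_ge0//; lra.
have le_op : 2^-1 ^+ grid_size z * 2^-1 ^+ grid_size w *
    expR (dot (u *m sign_mx f) (q *: v)) <= op_sum L f.
  rewrite /op_sum (bigD1 (z, w))//= lerDl sumr_ge0// => p _.
  by rewrite !mulr_ge0 ?exprn_ge0 ?expR_ge0 ?invr_ge0.
have uv : dot (u *m sign_mx f) v <= 16 * q.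
  suff : expR (dot (u *m sign_mx f) (q *: v)) <= expR (16 * k)%:R.
    rewrite ler_expR dotZr natrM -(@sqr_sqrtr _ k%:R)// -/q expr2 mulrCA.
    by rewrite ler_pM2l.
  have h : (2^-1 ^+ (8 * k)) * expR (dot (u *m sign_mx f) (q *: v)) <=
      3 * (9 * expR 2) ^+ k.
    apply: le_trans opf; apply: le_trans le_op.
    rewrite ler_wpM2r ?expR_ge0// (_ : 8 * k = 4 * k + 4 * k)%N; last by lia.
    by rewrite exprD ler_pM ?exprn_ge0 ?invr_ge0 ?half.
  rewrite exprVn ler_pdivrMl ?exprn_gt0// in h; apply: le_trans h _.
  (* The three exponents absorb 2^(8k) <= e^(8k), 3 <= e^(2k) and 9 e^2 <= e^6, all from 2 <= e. *)
  have -> : (16 * k = 8 * k + (2 * k + 6 * k))%N by lia.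
  rewrite (eX (8 * k + (2 * k + 6 * k))%N) (exprD _ (8 * k)) (exprD _ (2 * k)).
  have pow2 n : 2 ^+ n <= expR 1 ^+ n :> R by rewrite lerXn2r ?nnegrE ?(ltW e0).
  apply: ler_pM (pow2 _) _; first by rewrite exprn_ge0.
    by rewrite mulr_ge0// exprn_ge0// mulr_ge0// expR_ge0.
  apply: ler_pM => //; first by rewrite exprn_ge0// mulr_ge0// expR_ge0.
    apply: (@le_trans _ _ (2 ^+ (2 * k))); last exact: pow2.
    apply: (@le_trans _ _ (2 ^+ 2)); first by lra.
    by rewrite ler_weXn2l//; [lra | lia].
  rewrite (exprM _ 6) (eX 2); apply: lerXn2r; rewrite ?nnegrE.
  - by rewrite mulr_ge0// exprn_ge0// ltW.
  - by rewrite exprn_ge0// ltW.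
  - rewrite (exprD _ 4 2) ler_pM2r ?exprn_gt0//.
    by apply: le_trans (pow2 4); lra.
rewrite {1}(directionK x) {1}(directionK y) -scalemxAl dotZl dotZr mulrA.
rewrite -/u -/v mulrC -mulrA ler_wpM2r ?mulr_ge0 ?norm2_ge0//.
Qed.

Lemma small_sum_norm1 L f (z : {ffun 'I_k -> 'I_L + 'I_L}) : (25 <= k)%N ->
    small_sum L f <= 3 * (15 / 19) ^+ k -> (120 * grid_size z <= k)%N ->
  k%:R / 20 * norm2 (grid_vec z : 'rV[R]_k) <= norm1 (grid_vec z *m sign_mx f).
Proof.
move=> k25 smallf zk; set x := grid_vec z.
have [->|x0] := eqVneq x 0.
  by rewrite mul0mx norm2_0 norm1_0 mulr0.
rewrite [X in _ <= norm1 (X *m _)](directionK x) -scalemxAl norm1Z.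
rewrite ger0_norm ?norm2_ge0// mulrC ler_wpM2l ?norm2_ge0//.
set N := norm1 _.
have [/andP[w0 _] _] := weight_bounds.
have h : (19 / 20) ^+ k * expR (- 2 * N) <= 3 * (15 / 19) ^+ k.
  apply: le_trans smallf; rewrite /small_sum (bigD1 z)//= -/x -/N.
  apply: (@le_trans _ _ (weight ^+ grid_size z * expR (- 2 * N))).
    rewrite ler_wpM2r ?expR_ge0// /weight -exprM ler_wiXn2l ?divr_ge0//.
    by lra.
  by rewrite lerDl sumr_ge0// => p _; rewrite mulr_ge0 ?weightX_ge0 ?expR_ge0.
have h2 : expR (- 2 * N) <= expR (- (k%:R / 10)).
  have e9 : (9 / 10) ^+ k <= expR (- (k%:R / 10)) :> R.
    have -> : - (k%:R / 10) = (- 10^-1) * k%:R :> R by ring.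
    rewrite expRM_natr lerXn2r ?nnegrE ?expR_ge0 ?divr_ge0//.
    by have := expR_ge1Dx (- 10^-1 : R); lra.
  apply: le_trans e9; rewrite -(ler_pM2l (_ : 0 < (19 / 20) ^+ k)); last first.
    by rewrite exprn_gt0 ?divr_gt0.
  apply: le_trans h _; rewrite -exprMn.
  (* The surplus 249/3000 absorbs the factor 3 by Bernoulli's inequality: 1 + 25 * 249/3000 >= 3,
     whence the condition 25 <= k. *)
  have -> : (19 / 20 * (9 / 10) : R) = (15 / 19) * (1 + 249 / 3000) by field.
  rewrite [in leRHS]exprMn [3 * _]mulrC ler_wpM2l ?exprn_ge0 ?divr_ge0//.
  have -> : (3 : R) = 1 + 2 by ring.
  apply: (@le_trans _ _ (1 + (249 / 3000) *+ k)).
    have : 25 <= k%:R :> R by rewrite ler_nat.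
    by rewrite -[_ *+ k]mulr_natr; lra.
  elim: (k) => [|n IH]; first by rewrite mulr0n addr0 expr0.
  rewrite exprS mulrSr; set t := _ *+ n in IH *.
  have t0 : 0 <= t by rewrite mulrn_wge0 ?divr_ge0.
  by nra.
by move: h2; rewrite ler_expR; lra.
Qed.

End GoodSigns.

(** * Operator norms through bilinear forms *)

Section OperatorNorm.
Context {R : realType} {k : nat}.
Implicit Types (a b : 'rV[R]_k) (M : 'M[R]_k).

Lemma dot_mulmx_tr M a b : dot (a *m M^T) b = dot (b *m M) a.
Proof.
rewrite /dot; under eq_bigr do rewrite mxE mulr_suml.
rewrite exchange_big; apply: eq_bigr => i _ /=.
rewrite [in RHS]mxE mulr_suml; apply: eq_bigr => j _.
by rewrite mxE; ring.
Qed.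

(** The bilinear form of the operator norm is symmetric under transposition and allows both
    arguments to be approximated. *)
Definition op_bound M (c : R) :=
  forall a b, dot (a *m M) b <= c * norm2 a * norm2 b.

Lemma op_bound_tr M c : op_bound M c -> op_bound M^T c.
Proof. by move=> Mc a b; rewrite dot_mulmx_tr mulrAC. Qed.

Lemma norm2_mulmx_le M c a : 0 <= c -> op_bound M c -> norm2 (a *m M) <= c * norm2 a.
Proof.
move=> c0 /(_ a (a *m M)); rewrite -sqr_norm2 expr2.
have [->|aM] := eqVneq (a *m M) 0; last by rewrite ler_pM2r// norm2_gt0.
by move=> _; rewrite norm2_0 mulr_ge0 ?norm2_ge0.
Qed.

Lemma norm2_direction n (x : 'rV[R]_n) : x != 0 -> norm2 (direction x) = 1.
Proof. by move=> x0; rewrite /norm2 dot_direction ?sqrtr1. Qed.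

Lemma op_bound_unit M c :
    (forall a b, norm2 a = 1 -> norm2 b = 1 -> dot (a *m M) b <= c) ->
  op_bound M c.
Proof.
move=> Mc a b; have [->|a0] := eqVneq a 0.
  by rewrite mul0mx dot0l norm2_0 mulr0 mul0r.
have [->|b0] := eqVneq b 0.
  by rewrite dotC dot0l norm2_0 mulr0.
rewrite {1}(directionK a) {1}(directionK b) -scalemxAl dotZl dotZr mulrA.
rewrite -[leRHS]mulrA mulrC ler_wpM2r ?mulr_ge0 ?norm2_ge0//.
by apply: Mc; rewrite norm2_direction.
Qed.

(* Approximating both vectors by the net reduces the optimal constant to
   d + c / 2, hence it is at most 2 d. *)
Lemma op_bound_fixpoint M c0 d : 0 <= c0 -> op_bound M c0 ->
    (forall c, 0 <= c -> op_bound M c -> op_bound M (d + c / 2)) -> 0 <= d ->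
  op_bound M (2 * d).
Proof.
move=> c00 Mc0 contr d0.
pose A := [set c | 0 <= c /\ op_bound M c].
have A0 : A !=set0 by exists c0.
have Alb : has_inf A by split=> //; exists 0 => c [].
(* The infimum is attained, since each condition defining A is closed in c. *)
have infA : A (inf A).
  split; first by apply: lb_le_inf => // c [].
  move=> a b; have [n0|n0] := eqVneq (norm2 a * norm2 b) 0.
    by have := Mc0 a b; rewrite -!mulrA n0 !mulr0.
  have n_gt0 : 0 < norm2 a * norm2 b by rewrite lt_def n0 mulr_ge0 ?norm2_ge0.
  rewrite -mulrA -ler_pdivrMr//; apply: lb_le_inf => // c [_ /(_ a b)].
  by rewrite -mulrA ler_pdivrMr.
have : inf A <= d + inf A / 2.
  apply: ge_inf; first by case: Alb.
  have [i0 iM] := infA; split; last exact: contr.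
  by rewrite addr_ge0// divr_ge0.
move=> le_inf a b; have [_ /(_ a b) /le_trans] := infA; apply.
by rewrite ler_wpM2r ?norm2_ge0// ler_wpM2r ?norm2_ge0//; lra.
Qed.

End OperatorNorm.

Lemma sqrt2_le2 (R : rcfType) : Num.sqrt 2 <= 2 :> R.
Proof.
have : 2 <= 2 ^+ 2 :> R by lra.
by move=> /ler_wsqrtr; rewrite sqrtr_sqr ger0_norm.
Qed.

(** * From grid points to all vectors *)

Section GoodSignMatrix.
Context {R : realType} {k : nat}.
Hypothesis k_gt0 : (0 < k)%N.
Implicit Types (a b : 'rV[R]_k) (f : {ffun 'I_k -> {ffun 'I_k -> bool}}).

Local Notation q := (Num.sqrt k%:R : R).

Let q_gt0 : 0 < q. Proof. by rewrite sqrtr_gt0 ltr0n. Qed.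

Let sqr_q : q * q = k%:R. Proof. by rewrite -expr2 sqr_sqrtr. Qed.

Lemma sign_mx_sign f : sign_matrix (sign_mx f : 'M[R]_k).
Proof. by move=> i j; rewrite mxE; case: (f j i); [right|left]. Qed.

(** Only finiteness matters: it makes the set of admissible constants nonempty in
    [op_bound_fixpoint]. *)
Lemma op_bound_crude f : op_bound (sign_mx f) (k%:R * q : R).
Proof.
move=> a b; apply: le_trans (dot_le_norm2 _ _) _.
rewrite ler_wpM2r ?norm2_ge0//; apply: le_trans (norm2_le_norm1 _) _.
apply: (@le_trans _ _ (\sum_(j < k) norm1 a)); last first.
  by rewrite sumr_const card_ord -[_ *+ k]mulr_natl -mulrA ler_wpM2l// norm1_le_norm2.
apply: ler_sum => j _; rewrite mxE; apply: le_trans (ler_norm_sum _ _ _) _.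
apply: ler_sum => i _; rewrite normrM mxE normrX normrN1 expr1n.
by rewrite mulr1.
Qed.

Lemma grid_size_le T (z : nat) a : norm2 a <= 1 ->
  z%:R <= T%:R * q * norm1 a -> (z <= T * k)%N.
Proof.
move=> a1 /le_trans zT; rewrite -(ler_nat R); apply: zT.
rewrite -mulrA natrM ler_wpM2l// -[leRHS]sqr_q ler_wpM2l ?(ltW q_gt0)//.
apply: le_trans (norm1_le_norm2 _) _.
by rewrite -[leRHS]mulr1 ler_wpM2l ?(ltW q_gt0).
Qed.

Lemma op_sum_op_bound L f : (4 * k < L)%N ->
  op_sum L f <= 3 * (9 * expR 2) ^+ k :> R -> op_bound (sign_mx f) (32 * q).
Proof.
move=> kL opf; rewrite [32 * q](_ : _ = 2 * (16 * q)); last by ring.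
apply: (@op_bound_fixpoint _ _ _ (k%:R * q)); last 1 first.
- by rewrite mulr_ge0 ?(ltW q_gt0).
- by rewrite mulr_ge0 ?(ltW q_gt0).
- exact: op_bound_crude.
move=> c c0 Bc; apply: op_bound_unit => u v u1 v1.
have u1' : norm2 u <= 1 by rewrite u1.
have v1' : norm2 v <= 1 by rewrite v1.
(* With T = 4 each vector is moved by at most 1/4, which costs c/4 + c/4 = c/2, and the grid sizes
   are at most 4 k, as [op_sum_dot] requires. *)
have [z [+ + zk]] := grid_net k_gt0 (isT : (0 < 4)%N) kL u1'.
set d := (_ * _)^-1; set x := d *: _ => ux x1.
have [w [+ + wk]] := grid_net k_gt0 (isT : (0 < 4)%N) kL v1'.
rewrite -/d; set y := d *: _ => vy y1.
have d0 : 0 < d by rewrite invr_gt0 mulr_gt0.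
have xy : dot (x *m sign_mx f) y <= 16 * q.
  rewrite -scalemxAl dotZl dotZr mulrA.
  have := op_sum_dot k_gt0 opf (grid_size_le u1' zk) (grid_size_le v1' wk).
  rewrite -(ler_pM2l (mulr_gt0 d0 d0)) => /le_trans; apply.
  have -> : d * d * (16 * q * norm2 (grid_vec z) * norm2 (grid_vec w)) =
      16 * q * (norm2 x * norm2 y).
    by rewrite !norm2Z gtr0_norm//; ring.
  rewrite -[leRHS]mulr1 ler_wpM2l ?mulr_ge0 ?(ltW q_gt0)//.
  by rewrite mulr_ile1 ?norm2_ge0 ?(le_trans x1) ?(le_trans y1).
have -> : dot (u *m sign_mx f) v = dot (x *m sign_mx f) y +
    (dot ((u - x) *m sign_mx f) v + dot (x *m sign_mx f) (v - y)).
  rewrite mulmxBl -!scaleN1r !(dotDl, dotDr, dotZl, dotZr).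
  by ring.
rewrite lerD//; have -> : c / 2 = c * 4^-1 + c * 4^-1 by field.
have step s t (a b : 'rV[R]_k) : norm2 a <= s -> norm2 b <= t ->
    s * t <= 4^-1 -> 0 <= s -> dot (a *m sign_mx f) b <= c * 4^-1.
  move=> as_ bt st s0; apply: le_trans (Bc a b) _; rewrite -mulrA ler_wpM2l//.
  by apply: le_trans st; rewrite ler_pM ?norm2_ge0.
apply: lerD.
  by apply: (step 4^-1 1); rewrite ?mulr1 ?invr_ge0.
by apply: (step 1 4^-1); rewrite ?mul1r ?ler01 ?(le_trans x1).
Qed.

Section SmallNorm1.
Variables (T L : nat) (f : {ffun 'I_k -> {ffun 'I_k -> bool}}).
Hypotheses (T_large : 32 * 80 <= T%:R :> R) (kL : (T * k < L)%N).
Hypothesis fop : op_bound (sign_mx f) (32 * q).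
Hypothesis fsmall : small_sum L f <= 3 * (15 / 19) ^+ k :> R.

Let T_gt0 : 0 < T%:R :> R. Proof. by apply: lt_le_trans T_large; lra. Qed.

(* Rounding a to the net changes the l1 norm of its image by at most k / 80. *)
Lemma norm1_mul_lower_unit a : norm2 a = 1 -> norm1 a <= q / (120 * T%:R) ->
  k%:R / 80 <= norm1 (a *m sign_mx f).
Proof.
move=> a1; rewrite ler_pdivlMr ?mulr_gt0// => asmall.
(* A unit vector has l1 norm at least 1, so the smallness of a forces sqrt k >= 120 T; for smaller k
   this case is empty. *)
have q_large : 120 * T%:R <= q.
  apply: le_trans asmall; rewrite -[leLHS]mul1r ler_wpM2r ?mulr_ge0//.
  by rewrite -a1 norm2_le_norm1.
have k25 : (25 <= k)%N.
  have q25 : 25 <= q by move: q_large T_large; move: T%:R => t; lra.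
  by rewrite -(ler_nat R) -[leRHS]sqr_q; nra.
have a1' : norm2 a <= 1 by rewrite a1.
have T0 : (0 < T)%N by rewrite -(ltr_nat R).
have [z [+ + zk]] := grid_net k_gt0 T0 kL a1'.
set d := (_ * _)^-1; set x := d *: _ => ax _.
have d0 : 0 < d by rewrite invr_gt0 mulr_gt0.
have t80 : 32 * T%:R^-1 <= 80^-1 :> R.
  by rewrite ler_pdivrMr// ler_pdivlMl// mulrC.
have x_ge : 2^-1 <= norm2 x.
  by have := norm2D (a - x) x; rewrite subrK a1; lra.
(* The threshold q / (120 T) was chosen for this: T q |a|_1 is at most q^2 / 120 = k / 120. *)
have z_small : (120 * grid_size z <= k)%N.
  rewrite -(ler_nat R) natrM -[leRHS]sqr_q.
  apply: (@le_trans _ _ (q * (norm1 a * (120 * T%:R)))).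
    have -> : q * (norm1 a * (120 * T%:R)) = 120 * (T%:R * q * norm1 a) by ring.
    by rewrite ler_wpM2l.
  by rewrite ler_wpM2l ?(ltW q_gt0).
have := small_sum_norm1 k25 fsmall z_small.
move=> /(ler_wpM2l (ltW d0)); rewrite (mulrCA d).
have -> : d * norm2 (grid_vec z) = norm2 x by rewrite norm2Z gtr0_norm.
have -> : d * norm1 (grid_vec z *m sign_mx f) = norm1 (x *m sign_mx f).
  by rewrite -scalemxAl norm1Z gtr0_norm.
move=> xlow.
have adiff : norm1 ((a - x) *m sign_mx f) <= k%:R / 80.
  apply: le_trans (norm1_le_norm2 _) _.
  rewrite -[X in X / 80]sqr_q -mulrA ler_wpM2l ?(ltW q_gt0)//.
  apply: le_trans (norm2_mulmx_le _ _ fop) _; first by rewrite mulr_ge0 ?(ltW q_gt0).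
  rewrite mulrAC mulrC ler_wpM2l ?(ltW q_gt0)//; apply: le_trans t80.
  by rewrite ler_wpM2l.
have : norm1 (x *m sign_mx f) <= norm1 ((x - a) *m sign_mx f) + norm1 (a *m sign_mx f).
  by rewrite mulmxBl; apply: le_trans (norm1D _ _); rewrite subrK.
rewrite -[x - a]opprB mulNmx -scaleN1r norm1Z normrN1 mul1r.
(* The rounded vector has norm at least 1/2, so its image has l1 norm at least k/40; rounding loses
   at most k/80. *)
have : k%:R / 20 * 2^-1 <= k%:R / 20 * norm2 x by rewrite ler_wpM2l// divr_ge0.
by lra.
Qed.

(** For a unit vector the l2 norm is at most 33 sqrt k, because 1 + 32^2 <= 33^2. The l1 norm is at
    least k / (120 T): the first half provides this above the threshold for |a|_1, the second half
    below it. *)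
Lemma norm2_graph_sign_le a :
  norm2 (graph_vec (sign_mx f) a) <=
  33 * (120 * T%:R) / q * norm1 (graph_vec (sign_mx f) a).
Proof.
have [->|a0] := eqVneq a 0.
  by rewrite (_ : graph_vec _ 0 = 0) ?norm2_0 ?norm1_0 ?mulr0//;
     apply/eqP; rewrite graph_vec_eq0.
rewrite (directionK a) graph_vecZ norm2Z norm1Z mulrCA ler_pM2l; last first.
  by rewrite normr_gt0 norm2_eq0.
have := norm2_direction a0; move: (direction a) => {a0}u u1.
have up : norm2 (graph_vec (sign_mx f) u) <= 33 * q.
  rewrite -(ler_pXn2r (ltn0Sn 1)) ?nnegrE ?mulr_ge0 ?norm2_ge0 ?(ltW q_gt0)//.
  rewrite sqr_norm2 dot_graph_vec -!sqr_norm2 u1 expr1n mulr1.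
  have := norm2_mulmx_le u (_ : 0 <= 32 * q) fop.
  rewrite u1 mulr1 mulr_ge0 ?(ltW q_gt0)// => /(_ isT) h.
  have : norm2 (u *m sign_mx f) ^+ 2 <= (32 * q) ^+ 2.
    by rewrite lerXn2r ?nnegrE ?norm2_ge0 ?mulr_ge0 ?(ltW q_gt0).
  rewrite !exprMn (@sqr_sqrtr _ k%:R)//; have : 0 <= k%:R :> R by [].
  by lra.
have low : k%:R <= 120 * T%:R * norm1 (graph_vec (sign_mx f) u).
  rewrite norm1_graph_vec.
  have n1 := norm1_ge0 (u *m sign_mx f).
  have [small|/ltW] := leP (norm1 u) (q / (120 * T%:R)); last first.
    rewrite ler_pdivrMr ?mulr_gt0// -(ler_pM2l q_gt0) sqr_q => /le_trans; apply.
    rewrite mulrA mulrC ler_wpM2l ?mulr_ge0 ?(ltW T_gt0)//.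
    by rewrite lerDl.
  have := norm1_mul_lower_unit u1 small; rewrite ler_pdivrMr// => /le_trans; apply.
  rewrite (mulrDr _ (q * _)) [leLHS]mulrC ler_wpDl//.
    by rewrite !mulr_ge0 ?norm1_ge0 ?(ltW q_gt0) ?(ltW T_gt0).
  by rewrite ler_wpM2r//; move: T_large; move: T%:R => t; lra.
apply: (le_trans up); rewrite mulrAC ler_pdivlMr// -mulrA sqr_q -mulrA.
by rewrite ler_wpM2l.
Qed.

End SmallNorm1.

Lemma exists_bounded_sign_matrix T : 32 * 80 <= T%:R :> R ->
  exists2 B : 'M[R]_k, sign_matrix B & Delta_bound B <= 66 * (120 * T%:R).
Proof.
move=> T_large; have T4 : (4 <= T)%N by rewrite -(ler_nat R); lra.
(* Since 4 <= T, one range serves both the net of mesh parameter 4 and that of parameter T. *)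
pose L := (T * k).+1; have kL : (T * k < L)%N by [].
have [f [small smallT opf]] := exists_good_signs (R := R) (k := k) L.
have fop : op_bound (sign_mx f) (32 * q).
  by apply: op_sum_op_bound opf; rewrite (leq_ltn_trans _ kL)// leq_mul2r T4 orbT.
exists (sign_mx f); first exact: sign_mx_sign.
have M0 : 0 <= 33 * (120 * T%:R) / q by rewrite divr_ge0 ?mulr_ge0 ?(ltW q_gt0).
have fB : max_Delta_ratio (sign_mx f) <= 33 * (120 * T%:R) / q.
  by apply: max_Delta_ratio_le => // a; apply: norm2_graph_sign_le T_large kL fop small _.
have fBT : max_Delta_ratio (sign_mx f)^T <= 33 * (120 * T%:R) / q.
  rewrite -sign_mx_tr; apply: max_Delta_ratio_le => // a.
  apply: norm2_graph_sign_le T_large kL _ smallT _.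
  by rewrite sign_mx_tr; apply: op_bound_tr.
have sq : Num.sqrt (2 * k%:R) <= 2 * q.
  rewrite sqrtrM// ler_wpM2r ?(ltW q_gt0)//.
  exact: sqrt2_le2.
have max_le : Num.max (max_Delta_ratio (sign_mx f)) (max_Delta_ratio (sign_mx f)^T)
    <= 33 * (120 * T%:R) / q.
  by rewrite ge_max; apply/andP; split; [exact: fB | exact: fBT].
have max_ge0 : 0 <= Num.max (max_Delta_ratio (sign_mx f))
    (max_Delta_ratio (sign_mx f)^T) :> R.
  by rewrite le_max; apply/orP; left; apply: max_Delta_ratio_ge0.
have := ler_pM (sqrtr_ge0 _) max_ge0 sq max_le.
move=> /le_trans; apply.
rewrite le_eqVlt; apply/orP; left; apply/eqP; field.
by rewrite gt_eqF.
Qed.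

End GoodSignMatrix.

Theorem corollary1 (R : realType) :
  (exists C : R, forall k : nat, (0 < k)%N ->
     exists B : 'M[R]_k, sign_matrix B /\ Delta_bound B <= C) /\
  (forall (k : nat) (B : 'M[R]_k), (1 < k)%N -> sign_matrix B ->
     Delta_bound B =
       Num.max (norm_distortion (sqrtI_span B))
               (norm_distortion (orth_compl (sqrtI_span B)))).
Proof.
split; last by move=> k B; apply: Delta_bound_eq.
exists (66 * (120 * (32 * 80)%:R)) => k k_gt0.
have T_large : 32 * 80 <= (32 * 80)%:R :> R by rewrite natrM.
by have [B signB boundB] := exists_bounded_sign_matrix k_gt0 T_large; exists B.
Qed.
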